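(* Let $X$ be the Cantor set and let $d\geq 2$. Let $F_d=\langle a_1,\dots,a_d\rangle$ be the free group on $d$ generators. The set of all actions $F_d\curvearrowright X$ in $\mathrm{WA}(F_d,X)$ such that each of the restriction actions $\langle a_k\rangle\curvearrowright X$ for $k=1,\dots,d$ factors onto the trivial action on the Cantor set is comeagre in $\mathrm{WA}(F_d,X)$.
   Context: Actions are by homeomorphisms. An action $\Gamma\curvearrowright X$ factors onto an action $\Gamma\curvearrowright Y$ if there is a $\Gamma$-equivariant continuous surjection $X\to Y$. $\mathrm{Act}(F_d,X)$ is the set of all actions $F_d\curvearrowright X$ with the (Polish) topology of elementwise uniform convergence: fixing a compatible metric $d_X$ on $X$, a basis is given by the sets $\{\beta : \sup_{x\in X} d_X(\beta_s x,\alpha_s x)<\delta \text{ for all } s\in E\}$ for $\alpha\in\mathrm{Act}(F_d,X)$, $E\subseteq F_d$ finite, $\delta>0$. $\mathrm{WA}(F_d,X)\subseteq \mathrm{Act}(F_d,X)$, with the subspace topology, is the set of actions that are minimal, topologically free (the set of points with trivial stabilizer is dense), topologically weakly mixing (for all nonempty open $U_1,U_2,V_1,V_2\subseteq X$ there is $s\in F_d$ with $sU_1\cap U_2\neq\emptyset$ and $sV_1\cap V_2\neq\emptyset$), and admit an $F_d$-invariant Borel probability measure on $X$. *)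

(* Defs.v *)
From HB Require Import structures.
From mathcomp Require Import all_boot all_order all_algebra.
From mathcomp Require Import finmap.
From mathcomp Require Import all_classical all_reals all_analysis.

Set Implicit Arguments.
Unset Strict Implicit.
Unset Printing Implicit Defensive.

Import Order.TTheory GRing.Theory Num.Theory.
Import numFieldNormedType.Exports.

Local Open Scope classical_set_scope.
Local Open Scope nat_scope.

(* The free group on d generators, as the group of reduced words.  The letter *)
(* (k, false) stands for the k-th generator and (k, true) for its inverse.    *)

Section FreeGroup.
Variable d : nat.

Definition letter : Type := ('I_d * bool)%type.
Implicit Types (x y : letter) (u v w : seq letter).

Definition linv x : letter := (x.1, ~~ x.2).

Definition reduced w := sorted (fun x y => y != linv x) w.

Definition lmul x w :=
  if w is y :: w' then if y == linv x then w' else x :: w else [:: x].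

Definition wmul u v := foldr lmul v u.

Definition winv w := rev (map linv w).

Lemma linvK : involutive linv.
Proof. by case=> k b; rewrite /linv /= negbK. Qed.

Lemma lmul_cons x w : reduced (x :: w) -> lmul x w = x :: w.
Proof. by case: w => [//|y w] /= /andP[/negbTE ->]. Qed.

Lemma reduced_lmul x w : reduced w -> reduced (lmul x w).
Proof.
case: w => [//|y w] rw; rewrite /lmul; case: ifPn => [_|yx].
  exact: path_sorted rw.
by rewrite /reduced /= yx.
Qed.

Lemma lmulK x w : reduced w -> lmul (linv x) (lmul x w) = w.
Proof.
case: w => [_|y w rw]; first by rewrite /= linvK eqxx.
rewrite {2}/lmul; case: eqP => [<-|_]; first exact: lmul_cons.
by rewrite /= linvK eqxx.
Qed.

Lemma reduced_wmul u v : reduced v -> reduced (wmul u v).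
Proof. by move=> rv; elim: u => //= x u; exact: reduced_lmul. Qed.

Lemma wmul_lmul x u w : reduced w -> wmul (lmul x u) w = lmul x (wmul u w).
Proof.
move=> rw; case: u => [//|y u]; rewrite {1}/lmul; case: eqP => [->|_] //=.
by rewrite -{1}(linvK x) lmulK// reduced_wmul.
Qed.

Lemma wmulA u v w : reduced w -> wmul u (wmul v w) = wmul (wmul u v) w.
Proof. by move=> rw; elim: u => //= x u ->; rewrite wmul_lmul. Qed.

Lemma wmulw1 w : reduced w -> wmul w [::] = w.
Proof.
elim: w => //= x w IHw rw; rewrite IHw ?lmul_cons//; exact: path_sorted rw.
Qed.

Lemma reduced_winv w : reduced w -> reduced (winv w).
Proof.
move=> rw; rewrite /reduced /winv rev_sorted sorted_map.
rewrite (@eq_sorted _ _ (fun x y => y != linv x))// => x y /=.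
by rewrite linvK; apply/idP/idP; apply: contra => /eqP; [move=> ->|move=> <-];
  rewrite ?linvK.
Qed.

Lemma winvK : involutive winv.
Proof.
move=> w; rewrite /winv map_rev revK -map_comp map_id_in// => x _.
exact: linvK.
Qed.

Lemma wmulVw w : reduced w -> wmul (winv w) w = [::].
Proof.
elim: w => //= x w IHw rw; rewrite /winv /= rev_cons /wmul foldr_rcons /=.
by rewrite linvK eqxx; apply: IHw; exact: path_sorted rw.
Qed.

Record free_group := FreeGroup { word : seq letter; word_reduced : reduced word }.

HB.instance Definition _ := [isSub for word].
HB.instance Definition _ := [Choice of free_group by <:].

Definition fg_one := @FreeGroup [::] isT.
Definition fg_mul (g h : free_group) :=
  FreeGroup (reduced_wmul (word g) (word_reduced h)).
Definition fg_inv (g : free_group) := FreeGroup (reduced_winv (word_reduced g)).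

Lemma fg_mulA : associative fg_mul.
Proof. by move=> g h k; apply: val_inj; exact: wmulA (word_reduced k). Qed.

Lemma fg_mul1g : left_id fg_one fg_mul.
Proof. by move=> g; apply: val_inj. Qed.

Lemma fg_mulg1 : right_id fg_one fg_mul.
Proof. by move=> g; apply: val_inj; exact: wmulw1 (word_reduced g). Qed.

Lemma fg_mulVg : left_inverse fg_one fg_inv fg_mul.
Proof. by move=> g; apply: val_inj; exact: wmulVw (word_reduced g). Qed.

Lemma fg_mulgV : right_inverse fg_one fg_inv fg_mul.
Proof.
move=> g; have invK : fg_inv (fg_inv g) = g by apply: val_inj; exact: winvK.
by rewrite -{1}invK fg_mulVg.
Qed.

HB.instance Definition _ := isGroup.Build free_group
  fg_mulA fg_mul1g fg_mulg1 fg_mulVg fg_mulgV.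

Definition fg_gen (k : 'I_d) : free_group := @FreeGroup [:: (k, false)] isT.

End FreeGroup.

Section CyclicSubgroup.
Variables (G : groupType) (g : G).
Local Open Scope group_scope.

Definition is_power : {pred G} :=
  fun h => `[< exists n : nat, h = g ^+ n \/ h = (g ^+ n)^-1 >].

Lemma is_powerP h :
  reflect (exists m n : nat, h = g ^+ m / g ^+ n) (h \in is_power).
Proof.
apply: (iffP (asboolP _)) => [[n [->|->]]|[m [n ->]]].
- by exists n, 0; rewrite divg1.
- by exists 0, n; rewrite mul1g.
- case: (leqP n m) => [le_nm|/ltnW le_mn].
  + by exists (m - n); left; rewrite -{1}(subnK le_nm) expgnDr mulgK.
  + exists (n - m); right.
    by rewrite -{1}(subnK le_mn) expgnDr invgM mulgA mulgV mul1g.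
Qed.

Lemma is_power_group_closed : group_closed is_power.
Proof.
split; first by apply/is_powerP; exists 0, 0; rewrite mulgV.
move=> _ _ /is_powerP[m [n ->]] /is_powerP[p [q ->]]; apply/is_powerP.
exists (m + q), (p + n); rewrite invgF !expgnDr invgM -!mulgA; congr (_ * _).
rewrite !mulgA; congr (_ * _).
by apply/commute_sym/commuteV/commuteX2; exact: commute_refl.
Qed.

Record cyclic_subgroup := CyclicSubgroup {
  cyc_val : G; cyc_valP : cyc_val \in is_power }.

HB.instance Definition _ := [isSub for cyc_val].
HB.instance Definition _ := [Choice of cyclic_subgroup by <:].
HB.instance Definition _ := SubChoice_isSubGroup.Build G is_power
  cyclic_subgroup is_power_group_closed.

End CyclicSubgroup.

Local Open Scope ring_scope.

Section Actions.

(* Each act s is a homeomorphism: act s^-1 is a continuous inverse.           *)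
Record caction (G : groupType) (X : topologicalType) := CAction {
  act :> G -> X -> X;
  act_continuous : forall s, continuous (act s);
  act1 : forall x, act 1%g x = x;
  actM : forall s t x, act (s * t)%g x = act s (act t x) }.

HB.instance Definition _ (G : groupType) (X : topologicalType) :=
  gen_eqMixin (caction G X).
HB.instance Definition _ (G : groupType) (X : topologicalType) :=
  gen_choiceMixin (caction G X).

Definition trivial_action (G : groupType) (X : topologicalType) : caction G X :=
  @CAction G X (fun _ x => x) (fun _ x => cvg_id) (fun _ => erefl)
    (fun _ _ _ => erefl).

HB.instance Definition _ (G : groupType) (X : topologicalType) :=
  isPointed.Build (caction G X) (trivial_action G X).

Definition restrict_cyclic (G : groupType) (X : topologicalType)
    (alpha : caction G X) (g : G) : caction (cyclic_subgroup g) X :=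
  @CAction (cyclic_subgroup g) X (fun s => alpha (val s))
    (fun s => @act_continuous _ _ alpha (val s)) (act1 alpha)
    (fun s t => actM alpha (val s) (val t)).

Definition factors_onto (G : groupType) (X Y : topologicalType)
    (alpha : caction G X) (beta : caction G Y) :=
  exists f : X -> Y,
    [/\ continuous f,
        forall y, exists x, f x = y &
        forall s x, f (alpha s x) = beta s (f x)].

End Actions.

#[short(type="pmetricType")]
HB.structure Definition PointedMetric (K : numDomainType) :=
  { M of Pointed M & Metric K M }.

Section ActTopology.
Context {R : realType} {G : groupType} {X : metricType R}.
Implicit Types (alpha beta : caction G X) (E : {fset G}) (delta : R).

(* The supremum is taken in \bar R, so that it is meaningful without any      *)
(* boundedness assumption on the metric.                                      *)
Definition sup_dist alpha beta (s : G) : \bar R :=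
  ereal_sup [set (mdist (beta s x) (alpha s x))%:E | x in [set: X]].

Definition act_ball alpha E delta : set (caction G X) :=
  [set beta | forall s, s \in E -> (sup_dist alpha beta s < delta%:E)%E].

Lemma act_ball_center alpha E delta : 0 < delta -> act_ball alpha E delta alpha.
Proof.
move=> delta0 s _; apply: (@le_lt_trans _ _ 0%E); last by rewrite lte_fin.
by apply: ge_ereal_sup => _ [x _ <-]; rewrite mdistxx.
Qed.

Lemma act_ball_nbhs alpha E delta beta : act_ball alpha E delta beta ->
  exists2 e, 0 < e & act_ball beta E e `<=` act_ball alpha E delta.
Proof.
move=> Hbeta; suff aux (s : seq G) : {subset s <= E} ->
    exists2 e, 0 < e & forall gamma, act_ball beta E e gamma ->
      forall t, t \in s -> (sup_dist alpha gamma t < delta%:E)%E.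
  have [e e0 He] := aux (enum_fset E) (fun _ => id).
  by exists e => // gamma Hgamma t; exact: He.
elim: s => [_|s E' IHE E'E]; first by exists 1.
have sE : s \in E by apply: E'E; rewrite mem_head.
have [|e e0 He] := IHE.
  by move=> t tE; apply: E'E; rewrite inE tE orbT.
have [r /andP[sr rd]] :
    exists r : R, (sup_dist alpha beta s <= r%:E)%E && (r < delta).
  have := Hbeta s sE; case: (sup_dist alpha beta s) => [r|//|_].
    by rewrite lte_fin => rd; exists r; rewrite lexx.
  by exists (delta - 1); rewrite leNye ltrBlDr ltrDl ltr01.
exists (Num.min e (delta - r)); first by rewrite lt_min e0 subr_gt0.
move=> gamma Hgamma t; rewrite inE => /orP[/eqP ->|tE]; last first.
  apply: He tE => u uE; apply: lt_le_trans (Hgamma u uE) _.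
  by rewrite lee_fin ge_min lexx.
have Hs : (sup_dist beta gamma s < (delta - r)%:E)%E.
  apply: lt_le_trans (Hgamma s sE) _.
  by rewrite lee_fin ge_min lexx orbT.
apply: (@le_lt_trans _ _ (sup_dist beta gamma s + r%:E)%E); last first.
  by rewrite -[delta](subrK r) EFinD lteD2rE.
apply: ge_ereal_sup => _ [x _ <-].
apply: (@le_trans _ _ ((mdist (gamma s x) (beta s x))%:E +
                       (mdist (beta s x) (alpha s x))%:E)%E).
  by rewrite -EFinD lee_fin metric_triangle.
apply: leeD; first by apply: ereal_sup_ubound; exists x.
by apply: le_trans sr; apply: ereal_sup_ubound; exists x.
Qed.

Lemma act_ball_cover :
  \bigcup_(i in [set i : caction G X * {fset G} * R | 0 < i.2])
    act_ball i.1.1 i.1.2 i.2 = setT.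
Proof.
rewrite -subTset => alpha _; exists (alpha, fset0, 1) => /=; first exact: ltr01.
exact/act_ball_center/ltr01.
Qed.

Lemma act_ball_join (i j : caction G X * {fset G} * R) beta :
  0 < i.2 -> 0 < j.2 -> act_ball i.1.1 i.1.2 i.2 beta ->
  act_ball j.1.1 j.1.2 j.2 beta ->
  exists k : caction G X * {fset G} * R,
    [/\ 0 < k.2, act_ball k.1.1 k.1.2 k.2 beta &
        act_ball k.1.1 k.1.2 k.2 `<=`
          act_ball i.1.1 i.1.2 i.2 `&` act_ball j.1.1 j.1.2 j.2].
Proof.
move=> _ _ /act_ball_nbhs[e e0 He] /act_ball_nbhs[e' e'0 He'].
have m0 : 0 < Num.min e e' by rewrite lt_min e0.
exists (beta, (i.1.2 `|` j.1.2)%fset, Num.min e e') => /=; split => //.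
  exact: act_ball_center.
move=> gamma Hg; split.
- apply: He => s sE; apply: lt_le_trans (Hg s _) _.
    by rewrite in_fsetU sE.
  by rewrite lee_fin ge_min lexx.
- apply: He' => s sE; apply: lt_le_trans (Hg s _) _.
    by rewrite in_fsetU sE orbT.
  by rewrite lee_fin ge_min lexx orbT.
Qed.

HB.instance Definition _ := @isBaseTopological.Build (caction G X)
  [the pointedType of (caction G X * {fset G} * R)%type] [set i | 0 < i.2]
  (fun i => act_ball i.1.1 i.1.2 i.2) act_ball_cover act_ball_join.

End ActTopology.

Section WA.
Context {R : realType} {G : groupType} {X : pmetricType R}.
Implicit Type alpha : caction G X.

Definition minimal_action alpha := forall x, dense (range (alpha ^~ x)).

Definition topologically_free alpha :=
  dense [set x | forall s, alpha s x = x -> s = 1%g].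

Definition topologically_weakly_mixing alpha :=
  forall U1 U2 V1 V2 : set X, open U1 -> open U2 -> open V1 -> open V2 ->
  U1 !=set0 -> U2 !=set0 -> V1 !=set0 -> V2 !=set0 ->
  exists s, (alpha s @` U1 `&` U2 !=set0) /\ (alpha s @` V1 `&` V2 !=set0).

Definition has_invariant_probability alpha :=
  exists mu : probability (g_sigma_algebraType (@open X)) R,
    forall s (A : set (g_sigma_algebraType (@open X))), measurable A ->
      mu (alpha s @` A) = mu A.

Definition WA : set (caction G X) :=
  [set alpha | [/\ minimal_action alpha, topologically_free alpha,
    topologically_weakly_mixing alpha & has_invariant_probability alpha]].

End WA.

Section Category.
Context {T : topologicalType}.

Definition nowhere_dense (A : set T) := (closure A)^° = set0.

Definition meagre (A : set T) :=
  exists N : (set T)^nat, (forall n, nowhere_dense (N n)) /\ A `<=` \bigcup_n N n.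

Definition comeagre (A : set T) := meagre (~` A).

End Category.

Definition homeomorphic (X Y : topologicalType) :=
  exists (f : X -> Y) (g : Y -> X),
    [/\ continuous f, continuous g, cancel f g & cancel g f].

(* Main.v *)
Require Import Defs.
From HB Require Import structures.
From mathcomp Require Import all_boot all_order all_algebra.
From mathcomp Require Import finmap.
From mathcomp Require Import all_classical all_reals all_analysis.
From mathcomp Require Import zify lra.

(* For a fixed generator [a_k] and clopen set [A], consider the actions for   *)
(* which [A] is empty, or not [a_k]-invariant, or splits into two nonempty    *)
(* [a_k]-invariant clopen pieces. This is an open set of actions, and an      *)
(* action lying in all these sets has a binary tree of invariant clopen sets, *)
(* that is, an invariant map onto the Cantor set. It remains to prove density. *)
(*   Given [alpha] in WA, let [b] be another generator and let [e] count the  *)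
(* exponent of [b]. For a homeomorphism [T] of the Cantor set [C], the action *)
(* [s |-> alpha_s x T^(e s)] on [X x C] has [a_k] acting trivially on [C], and *)
(* [X x C] can be identified with [X] by a homeomorphism that is close to the *)
(* projection. We choose [T] depending on [alpha]: it is a rank-one subshift  *)
(* with blocks [B_(n+1) = B_n^(k_n) 1 B_n], where [k_n] grows fast.           *)
(* - Minimality: a weakly mixing minimal action has no finite factor, so for  *)
(*   each [h] the elements [s] with [h] dividing [e s] and [|e s|] bounded    *)
(*   bring every point of [X] close to every other one, while every point of  *)
(*   [C] has long [h_n]-periodic stretches.                                   *)
(* - Weak mixing: the transition times of [T] contain arbitrarily long        *)
(*   intervals, and Poincare recurrence for [mu x mu] along suitable powers of *)
(*   [b] provides simultaneous returns in [X].                                *)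
(* - Invariant measure: a Banach limit of the [mu]-measures of the slices over *)
(*   a [T]-orbit is an invariant content on clopen sets.                      *)

Set Implicit Arguments.
Unset Strict Implicit.
Unset Printing Implicit Defensive.

Import Order.TTheory GRing.Theory Num.Theory.
Import numFieldNormedType.Exports.
Local Open Scope classical_set_scope.

(** * A rank-one word *)

(** The exceptional actions are covered by countably many sets, one for each generator and clopen
    set: [splits_open] shows that their complements are open, [splits_dense] that these complements
    are dense, and [splits_factors_onto] that an action outside all of them has the factor maps.
    Density rests on multiplying [alpha] by an integer flow driven by an exponent sum that vanishes
    on [a_k]. The product could fail to be minimal or weakly mixing if the flow were correlated with
    [alpha], and the order of choices prevents this. First [uniform_visit_mod] extracts from [alpha]
    a bound [Lam n h] on the time needed to move any point near any other one through times
    divisible by [h]. Then [thick_periodic_flow] builds a rank-one flow whose [h]-periodic stretches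
    outlast this bound, which gives [product_minimal]. The single spacers still make the transition
    times flexible enough for [product_weakly_mixing], and [product_invariant_probability] averages
    slices along one orbit of the flow. *)

Section RankOneWord.
Variable Lam : nat -> nat -> nat.

(** Minimality of the product consumes [Lam n h] copies of the block on either side of a middle
    copy. *)
Let K n h := (Lam n h).*2.+3.

Fixpoint tower n := if n is m.+1 then (K m (tower m)).+1 * tower m + 1 else 1.

Let k n := K n (tower n).

Fixpoint block n t :=
  if n is m.+1 then
    if t < k m * tower m then block m (t %% tower m)
    else (t == k m * tower m) || block m (t - (k m * tower m).+1)
  else false.

(** The origin is placed in the second copy of each block inside the next one, so the centred blocks
    exhaust the integers in both directions. *)
Fixpoint centre n := if n is m.+1 then tower m + centre m else 0.

Lemma tower_gt0 n : 0 < tower n. Proof. by case: n => //= n; lia. Qed.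

Lemma block_copy n i t : i < (Lam n (tower n)).*2.+3 -> t < tower n ->
  block n.+1 (i * tower n + t) = block n t.
Proof.
move=> ik th /=; rewrite ifT.
  by rewrite modnMDl modn_small.
by rewrite /k /K; nia.
Qed.

Lemma block_last n t : t < tower n ->
  block n.+1 ((Lam n (tower n)).*2.+3 * tower n + 1 + t) = block n t.
Proof.
move=> th /=; rewrite ifF; last by apply/negbTE; rewrite /k /K -leqNgt; lia.
rewrite gtn_eqF ?orFb; last by rewrite /k /K; lia.
by congr (block n _); rewrite /k /K; lia.
Qed.

Lemma block_spacer n : block n.+1 ((Lam n (tower n)).*2.+3 * tower n) = true.
Proof. by rewrite /= ltnn eqxx. Qed.

Lemma centre_ge n : n <= centre n.
Proof. by elim: n => //= n IH; have := tower_gt0 n; lia. Qed.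

Lemma centre_lt n : centre n + n < tower n.
Proof. by elim: n => //= n IH; rewrite /K; nia. Qed.

Lemma block_centre n N t : n <= N -> t < tower n ->
  centre n <= centre N /\ t + (centre N - centre n) < tower N /\
  block N (t + (centre N - centre n)) = block n t.
Proof.
elim: N => [|N IH]; first by rewrite leqn0 => /eqP -> th; rewrite subnn addn0.
rewrite leq_eqVlt => /predU1P[<- th|nN th]; first by rewrite subnn addn0.
have [cle [lt eqb]] := IH nN th; rewrite -eqb.
have E : t + (centre N.+1 - centre n) = 1 * tower N + (t + (centre N - centre
  n)).
  by rewrite /=; lia.
split; first by rewrite /=; lia.
rewrite E; split; first by rewrite /= /K; nia.
by rewrite block_copy.
Qed.

(** Level [|i|] suffices: by [centre_ge] and [centre_lt] the centred block of that level covers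
    position [i]. *)
Definition rank_one (i : int) : bool :=
  block `|i|%N `|(i + (centre `|i|%N)%:Z)%R|%N.

Lemma rank_one_block n t : t < tower n -> rank_one (t%:Z - (centre n)%:Z)%R =
  block n t.
Proof.
move=> th; rewrite /rank_one; set i := (t%:Z - _)%R; set N := `|i|%N.
have [c1 [lt1 b1]] := @block_centre n (maxn n N) t (leq_maxl _ _) th.
have cN := centre_ge N; have cN' := centre_lt N.
have jh : `|(i + (centre N)%:Z)%R|%N < tower N by lia.
have [c2 [lt2 b2]] := @block_centre N (maxn n N) _ (leq_maxr _ _) jh.
by rewrite -b1 -b2; congr (block _ _); lia.
Qed.

Definition occurs (y : int -> bool) n (p : int) :=
  forall t, t < tower n -> y (p + t%:Z)%R = block n t.

Lemma occurs_centre n : occurs rank_one n (- (centre n)%:Z)%R.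
Proof. by move=> t th; rewrite addrC rank_one_block. Qed.

Lemma occurs_copy y n i p : i < (Lam n (tower n)).*2.+3 ->
  occurs y n.+1 p -> occurs y n (p + (i * tower n)%N%:Z)%R.
Proof.
move=> ik oy t th; rewrite -(block_copy ik th) -oy /=; last by rewrite /K; nia.
by congr (y _); lia.
Qed.

Lemma occurs_last y n p : occurs y n.+1 p ->
  occurs y n (p + ((Lam n (tower n)).*2.+3 * tower n + 1)%N%:Z)%R.
Proof.
move=> oy t th; rewrite -(block_last th) -oy /=; last by rewrite /K; nia.
by congr (y _); lia.
Qed.

(** At most one spacer separates successive copies of a block, so the intervals from [q] to
    [q + tower n], with both ends included, leave no gap. *)
Lemma occurs_gap_block y n N p t : n <= N -> occurs y N p -> t <= tower N ->
  exists q, [/\ occurs y n q, (q <= p + t%:Z)%R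
    & (p + t%:Z <= q + (tower n)%:Z)%R].
Proof.
elim: N p t => [|N IH] p t.
  by rewrite leqn0 => /eqP -> oy tle; exists p; split => //; lia.
rewrite leq_eqVlt => /predU1P[->|nN] oy tle; first by exists p; split => //;
  lia.
have hN := tower_gt0 N.
have [tk|tk] := leqP t ((Lam N (tower N)).*2.+3 * tower N).
  have [i [ik ti ti']] : exists i, [/\ i < (Lam N (tower N)).*2.+3,
      i * tower N <= t & t <= i * tower N + tower N].
    have [t0|t0] := posnP t; first by exists 0; rewrite t0.
    (* The predecessor makes a common endpoint belong to the copy on its left, which also absorbs
       the spacer position. *)
    exists (t.-1 %/ tower N); have := leq_trunc_div t.-1 (tower N).
    have := ltn_ceil t.-1 hN; rewrite mulSn => *; split; [|lia|lia].
    by rewrite ltn_divLR//; lia.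
  have := IH _ (t - i * tower N) nN (occurs_copy ik oy).
  case=> [|q [oq q1 q2]]; first by lia.
  by exists q; split => //; lia.
have := IH _ (t - ((Lam N (tower N)).*2.+3 * tower N + 1)) nN (occurs_last oy).
move: tle => /=; rewrite /K => tle.
case=> [|q [oq q1 q2]]; first by lia.
by exists q; split => //; lia.
Qed.

Lemma occurs_rank_one_gap n (p : int) :
  exists q, [/\ occurs rank_one n q, (p <= q)%R & (q <= p + (tower n)%:Z)%R].
Proof.
pose i := (p + (tower n)%:Z)%R; pose N := maxn n `|i|%N.
have cN := centre_ge N; have cN' := centre_lt N.
have [|q [oq q1 q2]] := @occurs_gap_block rank_one n N _ `|(i + (centre
  N)%:Z)%R|%N
  (leq_maxl _ _) (@occurs_centre N); first by lia.
by exists q; split => //; lia.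
Qed.

(* Replacing a step [h_n] between two consecutive copies of the block by the  *)
(* step [h_n + 1] across the spacer gains one unit of freedom per level.      *)
Lemma occurs_interval r n : exists H : nat, forall e, e <= r ->
  exists p, occurs rank_one n p /\ occurs rank_one n (p + (H + e)%N%:Z)%R.
Proof.
elim: r n => [|r IH] n.
  exists 0 => e; rewrite leqn0 => /eqP ->; exists (- (centre n)%:Z)%R.
  by rewrite addr0; split; exact: occurs_centre.
have [H HP] := IH n.+1; exists (H + tower n) => e er.
have [el|el] := leqP e r.
  have [p [ocp ocq]] := HP e el; exists (p + (0 * tower n)%N%:Z)%R; split.
    exact: occurs_copy ocp.
  have -> : (p + (0 * tower n)%N%:Z + (H + tower n + e)%N%:Z)%R
     = ((p + (H + e)%N%:Z) + (1 * tower n)%N%:Z)%R by lia.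
  exact: occurs_copy ocq.
have [p [ocp ocq]] := HP r (leqnn r).
exists (p + ((Lam n (tower n)).*2.+2 * tower n)%N%:Z)%R; split.
  by apply: occurs_copy ocp; lia.
have -> : (p + ((Lam n (tower n)).*2.+2 * tower n)%N%:Z
    + (H + tower n + e)%N%:Z)%R = ((p + (H + r)%N%:Z) +
      ((Lam n (tower n)).*2.+3 * tower n + 1)%N%:Z)%R by lia.
exact: occurs_last ocq.
Qed.

Lemma rank_one_nonconstant : exists i j, rank_one i != rank_one j.
Proof.
exists ((0%N)%:Z - (centre 0)%:Z)%R; rewrite rank_one_block//.
exists (((Lam 0 1).*2.+3 * tower 0)%N%:Z - (centre 1)%:Z)%R.
rewrite rank_one_block; last by rewrite /= /K /=; lia.
by rewrite (block_spacer 0).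
Qed.

End RankOneWord.

(** * The associated subshift *)

Lemma continuous_prod (I : Type) (K : I -> topologicalType) (T :
  topologicalType)
    (f : T -> prod_topology K) :
  (forall i, continuous (fun x => f x i)) -> continuous f.
Proof.
move=> cf x; apply/cvg_sup => i U [V [[W oW <-] Wfx WU]].
by apply: filterS WU _; apply: cf; exact: open_nbhs_nbhs.
Qed.

(** The windows generate a filter that fixes each coordinate eventually, so it converges to [x]. *)
Lemma nbhs_prod_window (I : Type) (K : I -> topologicalType) (rk : I -> nat)
    (x : prod_topology K) (V : set (prod_topology K)) : nbhs x V ->
  exists N, forall y, (forall i, (rk i <= N)%N -> y i = x i) -> V y.
Proof.
pose B N := [set y : prod_topology K | forall i, (rk i <= N)%N -> y i = x i].
pose F : set_system (prod_topology K) := filter_from setT B.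
have FF : Filter F.
  apply: filter_from_filter; first by exists 0%N.
  move=> i j _ _; exists (maxn i j) => // y yB; split => k ki; apply: yB.
    by rewrite leq_max ki.
  by rewrite leq_max ki orbT.
have Fx : F --> (x : prod_topology K).
  apply/cvg_sup => i U [W [[W' oW' <-] Wfx WU]].
  by apply: filterS WU _; exists (rk i) => // y /(_ i (leqnn _)) /= yx;
     rewrite /proj yx.
by move=> /Fx[N _ NV]; exists N => y ynx; apply: NV.
Qed.


Lemma compact_set_type (X : topologicalType) (A : set X) :
  compact A -> compact [set: set_type A].
Proof.
move=> cA; apply/compact_near_coveringP => I F P FF PF.
have /compact_near_coveringP/near_covering_withinP cA' := cA.
have H := cA' I F (fun i x => forall Ax : x \in A, P i (exist _ x Ax)) FF.
have {}H : \forall i \near F, A `<=` fun x => forall Ax : x \in A,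
  P i (exist _ x Ax).
  apply: H => x Ax.
  have [[U G] /= [nU FG] UG] := PF (exist _ x (mem_set Ax)) Logic.I.
  case: nU => W [[V oV <-] /= Vx WU].
  exists (V, G) => /=; first by split => //; exact: open_nbhs_nbhs.
  move=> [y i] /= [Vy Gi] Ay Ay'; apply: (UG (_, i)); split => //=.
  exact: WU.
by apply: filterS H => i Pi [x Ax] _; apply: Pi; exact: set_mem.
Qed.

Definition zbits : Type := prod_topology (fun _ : int => discrete_topology
  bool).
HB.instance Definition _ := Pointed.on zbits.
HB.instance Definition _ := Uniform.on zbits.
HB.instance Definition _ (R : realType) : @PseudoMetric R _ :=
  @PseudoMetric.on zbits.

Definition zshift (j : int) (y : zbits) : zbits := fun i => y (j + i)%R.

Lemma zbits_coord_continuous (i : int) :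
  continuous (fun y : zbits => y i : discrete_topology bool).
Proof. exact: (@proj_continuous int (fun=> discrete_topology bool) i). Qed.

Lemma zbits_window_open (y : zbits) N :
  open [set z : zbits | forall i : int, (`|i| <= N)%N -> z i = y i].
Proof.
elim: N => [|N IH].
  rewrite (_ : mkset _ = (fun z : zbits => z 0%R : discrete_topology bool)
      @^-1` [set y 0%R]).
    apply: open_comp; last exact: discrete_open.
    by move=> z _; exact: zbits_coord_continuous.
  apply/seteqP; split => z /= zy; first exact: zy.
  by move=> i; rewrite leqn0 absz_eq0 => /eqP ->.
pose C (i : int) := (fun z : zbits => z i : discrete_topology bool) @^-1` [set
  y i].
have oC i : open (C i).
  apply: open_comp; last exact: discrete_open.
  by move=> z _; exact: zbits_coord_continuous.
rewrite (_ : mkset _ = [set z | forall i : int, (`|i| <= N)%N -> z i = y i]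
    `&` (C N.+1%:Z%R `&` C (- N.+1%:Z)%R)).
  by do 2 apply: openI => //.
apply/seteqP; split => z /=.
  move=> zy; split; first by move=> i iN; apply: zy; lia.
  by split; apply: zy; lia.
move=> [zy [zp zn]] i iN; have [iN'|iN'] := leqP `|i|%N N; first exact: zy.
by have [->|->] : i = N.+1%:Z%R \/ i = (- N.+1%:Z)%R by lia.
Qed.

Lemma zshift_continuous j : continuous (zshift j).
Proof. by apply: continuous_prod => i; exact: zbits_coord_continuous. Qed.

Lemma zbits_compact : compact [set: zbits].
Proof.
have cB : compact [set: discrete_topology bool].
  apply: finite_compact; rewrite (_ : setT = [set true; false]).
    exact: finite_set2.
  by apply/seteqP; split => -[] _ //=; [left|right].
have := @tychonoff _ (fun _ : int => discrete_topology bool) _ (fun=> cB).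
by congr (compact _); rewrite eqEsubset.
Qed.

Lemma cantor_like_homeomorphic (R : realType)
    (T : pseudoPMetricType R) : cantor_like T ->
  exists (f : cantor_space -> T) (g : T -> cantor_space),
    [/\ continuous f, continuous g, cancel f g & cancel g f].
Proof.
move=> /homeomorphism_cantor_like[f [cf clf]].
have fK : cancel f f^-1%FUN by move=> x; apply: (@funK _ _ _ f); rewrite inE.
have gK : cancel f^-1%FUN f by move=> x; apply: (@invK _ _ _ _ f); rewrite inE.
exists f, f^-1%FUN; split => //.
apply/continuous_closedP => A /clf; congr closed.
apply/seteqP; split => x /=; first by move=> [y Ay <-]; rewrite fK.
by move=> Ax; exists (f^-1%FUN x).
Qed.

(** * The orbit closure of the rank-one sequence is a Cantor set *)

Section Hull.
Variable Lam : nat -> nat -> nat.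
Local Notation rank_one := (rank_one Lam).
Local Notation tower := (tower Lam).
Local Open Scope ring_scope.

(** The shift-orbit closure of [rank_one], described through finite words. *)
Definition hull : set zbits := [set y | forall N : nat, exists p : int,
  forall i : int, (`|i| <= N)%N -> y i = rank_one (p + i)].

Lemma hull_rank_one : hull rank_one.
Proof. by move=> N; exists 0 => i _; rewrite add0r. Qed.

Lemma hull_zshift j y : hull y -> hull (zshift j y).
Proof.
move=> hy N; have [p py] := hy (N + `|j|)%N; exists (p + j) => i iN.
by rewrite /zshift py ?addrA//; lia.
Qed.

Lemma hull_closed : closed hull.
Proof.
move=> y /= cly N.
have [|z [hz zy]] := cly [set z | forall i : int, (`|i| <= N)%N -> z i = y i].
  by apply: open_nbhs_nbhs; split; [exact: zbits_window_open|].
by have [p pz] := hz N; exists p => i iN; rewrite -zy// pz.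
Qed.

(** A finite word of [rank_one] lies in every sufficiently large centred block, hence recurs at a
    fixed offset in each occurrence of that block. *)
Lemma hull_pattern y0 N : hull y0 -> exists M, forall n, (M <= n)%N ->
  exists s : int, forall y q, occurs Lam y n q ->
    forall i : int, (`|i| <= N)%N -> zshift (q + s) y i = y0 i.
Proof.
move=> /(_ N)[p py0]; exists (`|p| + N)%N => n Mn;
  exists ((centre Lam n)%:Z + p).
move=> y q oy i iN; rewrite py0// /zshift.
have cn := centre_ge Lam n; have cn' := centre_lt Lam n.
pose t := `|((centre Lam n)%:Z + p + i)%R|%N.
have th : (t < tower n)%N by rewrite /t; lia.
have := oy t th; rewrite -(rank_one_block th) => eqy.
have -> : q + ((centre Lam n)%:Z + p) + i = q + t%:Z by rewrite /t; lia.
by rewrite eqy; congr rank_one; rewrite /t; lia.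
Qed.

(** Blocks of level [n + 1] occur with bounded gaps in [rank_one], hence also in [y], and each
    begins with a run of blocks of level [n]. *)
Lemma hull_run y n : hull y -> exists q : int, forall i,
  (i < (Lam n (tower n)).*2.+3)%N -> occurs Lam y n (q + (i * tower n)%N%:Z).
Proof.
move=> hy; have [p py] := hy (2 * tower n.+1)%N.
have [q [oq q1 q2]] := occurs_rank_one_gap Lam n.+1 p; exists (q - p) => i iL.
apply: (@occurs_copy Lam _ _ _ _ iL) => t th; rewrite -oq// py; last by lia.
by congr rank_one; lia.
Qed.

(** If [y0] were isolated, shifting [rank_one] to any occurrence of a large block would give [y0].
    Occurrences at distances [H'] and [H' + 1] would then make [y0], and so [rank_one], constant. *)
Lemma hull_perfect y0 N : hull y0 -> exists y, [/\ hull y,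
  forall i : int, (`|i| <= N)%N -> y i = y0 i & y <> y0].
Proof.
move=> hy0; apply: contrapT => H.
have [M HM] := hull_pattern N hy0; have [s Hs] := HM M (leqnn M).
have uniq p : occurs Lam rank_one M p -> zshift (p + s) rank_one = y0.
  move=> op; apply: contrapT => ne; apply: H; exists (zshift (p + s) rank_one).
  by split => //; [exact: hull_zshift hull_rank_one|exact: Hs].
have [H' HH'] := occurs_interval Lam 1 M.
have [p [p1 p2]] := HH' 0%N isT; have [p' [p1' p2']] := HH' 1%N isT.
have eH i : y0 (i + H'%:Z) = y0 i.
  by rewrite -{2}(uniq _ p2) -{1}(uniq _ p1) /zshift; congr rank_one; lia.
have eH1 i : y0 (i + H'%:Z + 1) = y0 i.
  by rewrite -{2}(uniq _ p2') -{1}(uniq _ p1') /zshift; congr rank_one; lia.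
have cst i : y0 (i + 1) = y0 i.
  by rewrite -[LHS]eH -(eH1 i); congr y0; lia.
have cstn (n : nat) i : y0 (i + n%:Z) = y0 i.
  elim: n => [|n IH]; first by rewrite addr0.
  by rewrite -IH -(cst (i + n%:Z)); congr y0; lia.
have cst0 i : rank_one i = y0 0.
  have -> : rank_one i = y0 (i - (p + s)).
    by rewrite -(uniq _ p1) /zshift; congr rank_one; lia.
  have [/gez0_abs <-|i0] := leP 0 (i - (p + s)).
    by have := cstn `|(i - (p + s))%R|%N 0; rewrite add0r.
  have := cstn `|(i - (p + s))%R|%N (i - (p + s)); have -> // : i - (p + s) +
    `|(i - (p + s))%R|%N%:Z = 0 by lia.
have [i [j]] := rank_one_nonconstant Lam; by rewrite !cst0 eqxx.
Qed.

Lemma hull_zero_dimensional : zero_dimensional (set_type hull).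
Proof.
move=> x y xy; have [i xyi] : exists i : int, set_val x i <> set_val y i.
  apply/existsNP => H; move/eqP: xy; apply; apply: val_inj.
  exact: functional_extensionality_dep.
pose c (z : set_type hull) : discrete_topology bool := set_val z i.
have cc : continuous c.
  move=> z; apply: (@continuous_comp _ _ _ (set_val : set_type hull -> zbits)
    (fun y : zbits => y i : discrete_topology bool)).
    exact: initial_continuous.
  exact: zbits_coord_continuous.
exists (c @^-1` [set set_val x i]); split => //=; last by move/esym.
apply: preimage_clopen cc; split; first exact: discrete_open.
exact: discrete_closed.
Qed.

Lemma hull_hausdorff : hausdorff_space (set_type hull).
Proof.
move=> x y xy; apply/eqP; apply: contrapT => /negP/hull_zero_dimensional.
move=> [U [[oU cU] Ux Uy]].
have oUC : open (~` U) by exact: closed_openC.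
have [|z [Uz Uz']] := xy U (~` U) (open_nbhs_nbhs (conj oU Ux)).
  exact: open_nbhs_nbhs.
exact: Uz' Uz.
Qed.

Lemma hull_nbhs (x : set_type hull) (U : set (set_type hull)) : nbhs x U ->
  exists N, forall y : set_type hull,
    (forall i : int, (`|i| <= N)%N -> set_val y i = set_val x i) -> U y.
Proof.
move=> [W [[V oV <-] /= Vx WU]].
have /(@nbhs_prod_window int (fun=> discrete_topology bool) absz)[N HN] :
  nbhs (set_val x : zbits) V by exact: open_nbhs_nbhs.
by exists N => y yx; apply: WU; exact: HN.
Qed.

Lemma hull_cantor_like : cantor_like (set_type hull).
Proof.
split; [|exact: compact_set_type (subclosed_compact hull_closed zbits_compact _)
  |exact: hull_hausdorff|exact: hull_zero_dimensional].
apply/perfectTP => x ox; have [|N HN] := @hull_nbhs x [set x].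
  exact: open_nbhs_nbhs.
have [y [hy yx nyx]] := hull_perfect N (set_mem (svalP x)).
apply: nyx; have := HN (exist _ y (mem_set hy)) yx.
by move=> /(congr1 set_val).
Qed.

Definition hull_shift (j : int) (y : set_type hull) : set_type hull :=
  exist _ (zshift j (set_val y)) (mem_set (hull_zshift j (set_mem (svalP y)))).

Lemma hull_shift_continuous j : continuous (hull_shift j).
Proof.
have c : continuous (zshift j \o (set_val : set_type hull -> zbits)).
  move=> z; apply: continuous_comp; last exact: zshift_continuous.
  exact: initial_continuous.
move=> x U [W [[V oV <-] /= Vx WU]].
have nV : nbhs (zshift j (set_val x)) V by exact: open_nbhs_nbhs.
have sVU : (zshift j \o set_val) @^-1` V `<=` hull_shift j @^-1` U.
  by move=> z Vz; exact: WU.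
exact: (@filterS _ (nbhs x) _ _ _ sVU (c x V nV)).
Qed.

End Hull.

(** The third clause comes from the runs of [hull_run] and serves minimality; the fourth comes from
    [occurs_interval] and serves weak mixing. The hull is carried to [cantor_space] by Brouwer's
    characterization. *)
Lemma thick_periodic_flow (R : realType) (Lam : nat -> nat -> nat) :
  exists tau : int -> cantor_space -> cantor_space,
  [/\ (forall j, continuous (tau j)) /\ (forall y, tau 0%R y = y),
      forall i j y, tau (i + j)%R y = tau i (tau j y),
      forall (P : set cantor_space) n0, open P -> P !=set0 ->
        exists n h, [/\ (n0 <= n)%N, (0 < h)%N & forall y, exists m : int,
          forall i : int, (`|i| <= Lam n h)%N -> P (tau (m + i * h%:Z)%R y)] &
      forall (P1 P2 P3 P4 : set cantor_space) (r : nat),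
        open P1 -> open P2 -> open P3 -> open P4 ->
        P1 !=set0 -> P2 !=set0 -> P3 !=set0 -> P4 !=set0 ->
        exists L : nat, forall m : nat, (L <= m <= L + r)%N ->
          (exists y, P1 y /\ P2 (tau m%:Z%R y)) /\
          (exists y, P3 y /\ P4 (tau m%:Z%R y))].
Proof.
pose hpt : set_type (hull Lam) := exist _ (rank_one Lam) (mem_set
  (hull_rank_one Lam)).
pose Tp : pseudoPMetricType R :=
  HB.pack (set_type (hull Lam)) (isPointed.Build (set_type (hull Lam)) hpt).
have [f [g [cf cg fK gK]]] : exists (f : cantor_space -> set_type (hull Lam))
    (g : set_type (hull Lam) -> cantor_space),
    [/\ continuous f, continuous g, cancel f g & cancel g f].
  exact: (@cantor_like_homeomorphic R Tp (hull_cantor_like Lam)).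
exists (fun j => g \o hull_shift j \o f).
have shD i j y : hull_shift (i + j)%R y = hull_shift i (hull_shift j y) :>
  set_type (hull Lam).
  apply: val_inj; apply: functional_extensionality_dep => k /=.
  by rewrite /zshift; congr (\val y _); rewrite addrCA addrA.
have sh0 y : hull_shift 0%R y = y :> set_type (hull Lam).
  by apply: val_inj; apply: functional_extensionality_dep => k /=;
    rewrite /zshift add0r.
have pat (P : set cantor_space) : open P -> P !=set0 -> exists M, forall n,
    (M <= n)%N -> exists s : int, forall (y : set_type (hull Lam)) q,
    occurs Lam (set_val y) n q -> P (g (hull_shift (q + s)%R y)).
  move=> oP [z Pz].
  have nP : nbhs (g (f z)) P by rewrite fK; exact: open_nbhs_nbhs.
  have [N HN] := @hull_nbhs Lam (f z) _ (cg (f z) P nP).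
  have [M HM] := hull_pattern N (set_mem (svalP (f z))).
  exists M => n /HM[s Hs]; exists s => y q oy; apply: HN => i iN.
  exact: (Hs (set_val y) q oy i iN).
split.
- split=> [j|y]; last by rewrite /= sh0 fK.
  move=> y; apply: continuous_comp; first exact: cf.
  by apply: continuous_comp; [exact: hull_shift_continuous|exact: cg].
- by move=> i j y; rewrite /= gK shD.
- move=> P n0 oP P0; have [M HM] := pat P oP P0.
  exists (maxn M n0), (tower Lam (maxn M n0)); split.
  + exact: leq_maxr.
  + exact: tower_gt0.
  + move=> y; have [s Hs] := HM _ (leq_maxl M n0).
    have [q Hq] := hull_run (maxn M n0) (set_mem (svalP (f y))).
    set n := maxn M n0 in Hs Hq *; set h := tower Lam n in Hq *.
    (* Counting from the middle copy of the run, all indices with [|i| <= Lam n h] stay inside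
       it. *)
    exists (q + s + ((Lam n h).+1 * h)%N%:Z)%R => i iL /=.
    have := Hs (f y) _ (Hq `|((Lam n h).+1%:Z + i)%R|%N _).
    set a := (X in hull_shift X _); set b := (X in _ -> P (g (hull_shift X _))).
    have -> : a = b by rewrite /a /b; nia.
    by apply; lia.
- move=> P1 P2 P3 P4 r ocp1 ocp2 oP3 oP4 P10 P20 P30 P40.
  have [M1 HM1] := pat P1 ocp1 P10; have [M2 HM2] := pat P2 ocp2 P20.
  have [M3 HM3] := pat P3 oP3 P30; have [M4 HM4] := pat P4 oP4 P40.
  pose n := (M1 + M2 + M3 + M4)%N.
  have [s1 H1] := HM1 n ltac:(lia); have [s2 H2] := HM2 n ltac:(lia).
  have [s3 H3] := HM3 n ltac:(lia); have [s4 H4] := HM4 n ltac:(lia).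
  pose s := (`|s1| + `|s2| + `|s3| + `|s4|)%N.
  (* The offsets of the patterns inside the block change the required distance by at most [s] in
     either direction, whence the extra [2 * s]. *)
  have [H HH] := occurs_interval Lam (r + 2 * s)%N n.
  have key (t t' : int) (m : nat) (Q Q' : set cantor_space) :
      (`|t| + `|t'| <= s)%N -> (H + s <= m <= H + s + r)%N ->
      (forall (y : set_type (hull Lam)) q, occurs Lam (set_val y) n q ->
        Q (g (hull_shift (q + t)%R y))) ->
      (forall (y : set_type (hull Lam)) q, occurs Lam (set_val y) n q ->
        Q' (g (hull_shift (q + t')%R y))) ->
      exists y, Q y /\ Q' (g (hull_shift m%:Z%R (f y))).
    move=> ts mL HQ HQ'.
    have [|p [ocp ocq]] := HH `|(m%:Z + t - t' - H%:Z)%R|%N; first by lia.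
    exists (g (hull_shift (p + t)%R hpt)); split; first exact: HQ.
    rewrite gK -shD.
    have -> : (m%:Z + (p + t) = p + (H + `|(m%:Z + t - t' - H%:Z)%R|)%N%:Z +
      t')%R.
      by lia.
    exact: HQ'.
  exists (H + s)%N => m mL; split.
    by apply: (key s1 s2) => //; rewrite /s; lia.
  by apply: (key s3 s4) => //; rewrite /s; lia.
Qed.

(** * Weakly mixing minimal actions have no finite factor *)

Section ExponentSum.
Variables (d : nat) (j : 'I_d).
Local Open Scope ring_scope.

Definition letter_exponent (x : letter d) : int :=
  if x.1 == j then (if x.2 then -1 else 1) else 0.

Definition exponent_sum (g : free_group d) : int :=
  \sum_(x <- word g) letter_exponent x.

Lemma exponent_sumM g h : exponent_sum (g * h)%g = exponent_sum g +
  exponent_sum h.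
Proof.
rewrite /exponent_sum /=; elim: (word g) => [|x u IH] /=.
  by rewrite big_nil add0r.
rewrite big_cons -addrA -IH; case: (wmul u (word h)) => [|y w] /=.
  by rewrite big_cons !big_nil.
case: eqP => [->|_]; last by rewrite big_cons.
rewrite big_cons addrA /letter_exponent /=.
by case: eqP; case: x.2; rewrite /= ?subrr ?addNr ?addr0 ?add0r.
Qed.

Lemma exponent_sum_gen k : exponent_sum (fg_gen k) = (k == j)%:R.
Proof.
by rewrite /exponent_sum /= big_seq1 /letter_exponent /=; case: eqP.
Qed.

End ExponentSum.

Section ActionFacts.
Context {G : groupType} {X : topologicalType} (alpha : caction G X).

Lemma actV s x : alpha s^-1%g (alpha s x) = x.
Proof. by rewrite -actM mulVg act1. Qed.

Lemma actVr s x : alpha s (alpha s^-1%g x) = x.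
Proof. by rewrite -actM mulgV act1. Qed.

Lemma open_act_preimage s U : open U -> open (alpha s @^-1` U).
Proof. by move=> oU; apply: open_comp => // x _; exact: act_continuous. Qed.

End ActionFacts.

Section ExponentHom.
Context {G : groupType} (e : G -> int).
Hypothesis eM : forall s t, e (s * t)%g = (e s + e t)%R.

Lemma hom_int1 : e 1%g = 0%R.
Proof. by have := eM 1%g 1%g; rewrite mulg1; lia. Qed.

Lemma hom_intV s : e s^-1%g = (- e s)%R.
Proof. by have := eM s^-1%g s; rewrite mulVg hom_int1; lia. Qed.

Lemma hom_intX s n : e (s ^+ n)%g = (e s *+ n)%R.
Proof.
by elim: n => [|n IH]; rewrite ?expg0 ?hom_int1// expgS eM IH mulrS.
Qed.

Context {R : realType} {X : pmetricType R} (alpha : caction G X).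
Hypothesis min_alpha : minimal_action alpha.
Hypothesis wm_alpha : topologically_weakly_mixing alpha.
Variable b : G.
Hypothesis eb : e b = 1%R.

Lemma minimal_visit U x : open U -> U !=set0 -> exists g, U (alpha g x).
Proof.
move=> oU U0; have [y [Uy [g _ gx]]] := @min_alpha x U U0 oU.
by exists g; rewrite gx.
Qed.

(* For [x] in [X] let [T x] be the set of classes [q] mod [h] such that no    *)
(* [g] with [e g = q] moves [x] into [U]. The points where [T] is smallest    *)
(* form an open set on which [T] is constant, and weak mixing forces that     *)
(* value to be invariant under translation by [1].                            *)
Lemma minimal_visit_mod U x0 h : open U -> U !=set0 -> (0 < h)%N ->
  exists g, (h%:Z %| e g)%Z /\ U (alpha g x0).
Proof.
case: h => // h oU U0 _; apply: contrapT => noU.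
pose u : 'I_h.+1 := inZp 1.
pose c g := (u *~ e g)%R.
have cM s t : c (s * t)%g = (c s + c t)%R by rewrite /c eM mulrzDr.
have cV s : c s^-1%g = (- c s)%R by rewrite /c hom_intV mulrNz.
have cb : c b = u by rewrite /c eb.
have un (n : nat) : (u *+ n)%R = inZp n.
  elim: n => [|n IH]; first by apply: val_inj => /=; rewrite mod0n.
  by rewrite mulrS IH; apply: val_inj; rewrite /= modnDm.
pose T x := finset (fun q : 'I_h.+1 =>
    `[< forall g, c g = q -> ~ U (alpha g x) >]).
have T0 : (0%R : 'I_h.+1) \in T x0.
  rewrite inE; apply/asboolP => g cg Ug; apply: noU; exists g; split => //.
  move: cg; rewrite /c; case: (e g) => n /=.
    by rewrite -pmulrn un => /(congr1 val) /= /eqP; rewrite dvdzE /= /dvdn.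
  rewrite NegzE mulrNz -pmulrn un => /eqP; rewrite oppr_eq0 => /eqP.
  by move=> /(congr1 val) /= /eqP; rewrite dvdzE /= /dvdn.
have TM g x q : (q \in T (alpha g x)) = (q + c g \in T x)%R.
  rewrite !inE; apply/asboolP/asboolP => H k ck Uk.
    apply: (H (k * g^-1)%g); first by rewrite cM ck cV addrK.
    by rewrite -actM -mulgA mulVg mulg1.
  apply: (H (k * g)%g); first by rewrite cM ck.
  by rewrite actM.
have [n [x1 Tx1] minn] : exists2 n, exists x, #|T x| = n &
    forall x, (n <= #|T x|)%N.
  have exn : exists n, `[< exists x, #|T x| = n >].
    by exists #|T x0|; apply/asboolP; exists x0.
  exists (ex_minn exn); case: ex_minnP => n /asboolP // [x Tx] minn.
  by move=> y; apply: minn; apply/asboolP; exists y.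
pose S := T x1; pose V := [set x | T x \subset S].
have VS x : V x -> T x = S.
  by move=> Vx; apply/eqP; rewrite eqEcard; apply/andP; split;
    rewrite // /S Tx1.
(* A class outside [T x] is witnessed by a visit to the open set [U], so it stays outside nearby;
   there are finitely many classes. *)
have oV : open V.
  rewrite openE => x /fintype.subsetP Vx; rewrite /interior.
  have : \forall y \near x, forall q : 'I_h.+1, q \notin S -> q \notin T y.
    apply: filter_forall => q; have [qS|qS] := boolP (q \in S);
      first exact: nearW.
    have : ~ (forall g, c g = q -> ~ U (alpha g x)).
      by move=> H; move/negP: qS; apply; apply: Vx; rewrite inE; apply/asboolP.
    move=> /existsNP[g /not_implyP[cg /contrapT Ug]].
    have : nbhs x (alpha g @^-1` U).
      by apply: open_nbhs_nbhs; split => //; exact: open_act_preimage.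
    apply: filterS => y Uy _; rewrite inE; apply/asboolP => H.
    exact: (H g cg).
  apply: filterS => y H; apply/fintype.subsetP => q.
  by apply: contraLR; exact: H.
have V1 : V x1 by apply: subxx.
(* [W] is the translate of [V] by [b]. One [s] moving points of [V] both into [V] and into [W] makes
   [S] invariant under [c s] and [c s - u], hence under [u]. *)
pose W := alpha b^-1%g @^-1` V.
have W1 : W (alpha b x1) by rewrite /W /= actV.
have [s [[_ [[v1 Vv1 <-] Vsv1]] [_ [[v2 Vv2 <-] Wsv2]]]] := wm_alpha oV oV oV
  (open_act_preimage alpha b^-1%g oV) (ex_intro _ _ V1) (ex_intro _ _ V1)
  (ex_intro _ _ V1) (ex_intro _ _ W1).
have Ss q : (q \in S) = (q + c s \in S)%R.
  by rewrite -{1}(VS _ Vsv1) TM (VS _ Vv1).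
have Ss' q : (q \in S) = (q - u + c s \in S)%R.
  rewrite -{1}(VS _ Wsv2) TM TM (VS _ Vv2) cV cb; by [].
have Su q : (q \in S) = (q + u \in S)%R by rewrite Ss [RHS]Ss' addrK.
have Sall q : (q \in S) = (0%R \in S).
  have -> : q = (u *+ q)%R by rewrite un valZpK.
  by elim: (q : nat) => // k IH; rewrite mulrSr -Su.
(* Now [S] is everything or empty. The former contradicts a visit of the orbit of [x1] to [U]; the
   latter contradicts [T0] after moving [x0] into [V]. *)
have [S0|S0] := boolP (0%R \in S).
  have [g Ug] := minimal_visit x1 oU U0.
  have := Sall (c g); rewrite S0 inE => /asboolP; exact.
have [g Vg] := minimal_visit x0 oV (ex_intro _ _ V1).
have := TM g x0 (- c g)%R; rewrite addNr T0 (VS _ Vg) Sall.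
by move=> /idP; apply/negP.
Qed.

End ExponentHom.

(** * Cantor coordinates *)

Section Coordinates.
Context {X : topologicalType} (c : X -> cantor_space) (c' : cantor_space -> X).
Hypotheses (cc : continuous c) (cc' : continuous c').
Hypotheses (cK : cancel c c') (c'K : cancel c' c).

Definition cylinder n x := [set x' | forall i, (i < n)%N -> c x' i = c x i].

Lemma cylinder_refl n x : cylinder n x x. Proof. by []. Qed.

Lemma cantor_coord_continuous i : continuous (fun y : cantor_space => y i :
  bool).
Proof. exact: (@proj_continuous nat (fun=> bool) i). Qed.

Lemma coord_continuous i : continuous (fun x => c x i : bool).
Proof.
move=> x; apply: (@continuous_comp _ _ _ c (fun y : cantor_space => y i :
  bool)).
  exact: cc.
exact: cantor_coord_continuous.
Qed.

Lemma cylinder_open n x : open (cylinder n x).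
Proof.
elim: n => [|n IH].
  by rewrite (_ : cylinder 0 x = setT); [exact: openT|apply/seteqP; split].
rewrite (_ : cylinder n.+1 x = cylinder n x `&` (fun x => c x n : bool) @^-1`
  [set c x n]).
  apply: openI => //; apply: open_comp; last exact: discrete_open.
  by move=> z _; exact: coord_continuous.
apply/seteqP; split => z /=.
  by move=> zx; split => [i ni|]; apply: zx; rewrite ltnS// ltnW.
by move=> [zx zn] i; rewrite ltnS leq_eqVlt => /predU1P[->//|]; exact: zx.
Qed.

Lemma nbhs_cylinder x V : nbhs x V -> exists n, cylinder n x `<=` V.
Proof.
move=> xV; have nV : nbhs (c' (c x)) V by rewrite cK.
have [N HN] := @nbhs_prod_window nat (fun=> bool) id _ _ (cc' nV).
exists N.+1 => z zx; have := HN (c z); rewrite /= cK; apply => i iN.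
exact: zx.
Qed.

Lemma coord_compact : compact [set: X].
Proof.
have -> : [set: X] = c' @` [set: cantor_space].
  by apply/seteqP; split => // x _; exists (c x).
apply: (@continuous_compact _ _ c').
  exact: continuous_subspaceT.
exact: cantor_space_compact.
Qed.

(** A Lebesgue number argument, with cylinder depth as the scale. *)
Lemma cylinder_uniform (P : X -> X -> Prop) :
  (forall x : X, exists2 V : set X, nbhs x V & forall x1 x2, V x1 -> V x2 ->
    P x1 x2) ->
  exists n, forall x1 x2, cylinder n x1 x2 -> P x1 x2.
Proof.
move=> HV; have /compact_near_coveringP cX := coord_compact.
have := cX nat \oo (fun n x1 => forall x2, cylinder n x1 x2 -> P x1 x2) _.
case=> [x _|n _ Hn]; last by exists n => x1 x2; exact: (Hn n (leqnn n)).
have [V nV VP] := HV x; have [m mV] := nbhs_cylinder nV.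
exists (cylinder m x, [set n | (m <= n)%N]) => /=.
  split; last by exists m.
  by apply: open_nbhs_nbhs; split; [exact: cylinder_open|].
move=> [x1 n] /= [x1x mn] x2 x2x1; apply: VP; apply: mV => // i im.
by rewrite x2x1 ?x1x// (leq_trans im).
Qed.

(* Interleaving the coordinates beyond [m] identifies [X] with                *)
(* [X * cantor_space] in such a way that the first [m] coordinates of the     *)
(* [X]-component are unchanged.                                               *)
Definition interleave m (xy : X * cantor_space) : X :=
  c' (fun i => if (i < m)%N then c xy.1 i
    else if odd (i - m) then xy.2 (i - m)./2 else c xy.1 (m + (i - m)./2)%N).

Definition deinterleave m (z : X) : X * cantor_space :=
  (c' (fun i => if (i < m)%N then c z i else c z (m + (i - m).*2)%N),
   fun i => c z (m + i.*2.+1)%N).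

Lemma interleaveK m : cancel (interleave m) (deinterleave m).
Proof.
move=> [x y]; rewrite /interleave /deinterleave !c'K; congr (_, _).
  rewrite -[RHS]cK; congr c'; apply: functional_extensionality_dep => i.
  have [//|mi] := ltnP i m; rewrite ifF; last by lia.
  by rewrite addKn odd_double doubleK subnKC.
apply: functional_extensionality_dep => i; rewrite ifF; last by lia.
by rewrite addKn /= odd_double/=; congr (y _); lia.
Qed.

Lemma deinterleaveK m : cancel (deinterleave m) (interleave m).
Proof.
move=> z; rewrite /interleave /deinterleave !c'K.
rewrite -[RHS]cK; congr c'; apply: functional_extensionality_dep => i /=.
have [//|mi] := ltnP i m; case: ifPn => oi; first by congr (c z _); lia.
by rewrite ifF; [congr (c z _); lia|lia].
Qed.

Lemma interleave_cylinder m xy : cylinder m xy.1 (interleave m xy).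
Proof. by move=> i im; rewrite /interleave c'K im. Qed.

Lemma interleave_continuous m : continuous (interleave m).
Proof.
pose f (xy : X * cantor_space) : cantor_space := fun i =>
  if (i < m)%N then c xy.1 i
  else if odd (i - m) then xy.2 (i - m)./2 else c xy.1 (m + (i - m)./2)%N.
suff cf : continuous f.
  by move=> xy; exact: (@continuous_comp _ _ _ f c' xy (cf xy) (@cc' (f xy))).
apply: continuous_prod => i; rewrite /f.
have c1 k : continuous (fun xy : X * cantor_space => c xy.1 k : bool).
  move=> xy; apply: (@continuous_comp _ _ _ fst (fun x : X => c x k : bool)).
    exact: cvg_fst.
  exact: coord_continuous.
case: (i < m)%N; first exact: c1.
case: (odd (i - m)); last exact: c1.
move=> xy; apply: (@continuous_comp _ _ _ snd
  (fun y : cantor_space => y (i - m)./2 : bool)); first exact: cvg_snd.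
exact: cantor_coord_continuous.
Qed.

Lemma deinterleave_continuous m : continuous (deinterleave m).
Proof.
have cx : continuous (fun z => (deinterleave m z).1).
  pose f (z : X) : cantor_space := fun i =>
    if (i < m)%N then c z i else c z (m + (i - m).*2)%N.
  suff cf : continuous f.
    by move=> z; exact: (@continuous_comp _ _ _ f c' z (cf z) (@cc' (f z))).
  apply: continuous_prod => i; rewrite /f.
  by case: (i < m)%N; exact: coord_continuous.
have cy : continuous (fun z => (deinterleave m z).2).
  by apply: continuous_prod => i; exact: coord_continuous.
by move=> z; exact: (cvg_pair (cx z) (cy z)).
Qed.

End Coordinates.

(** * Uniform bounds for visits in prescribed residue classes *)

Section UniformVisit.
Context {G : groupType} (e : G -> int).
Hypothesis eM : forall s t, e (s * t)%g = (e s + e t)%R.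
Variable b : G.
Hypothesis eb : e b = 1%R.
Context {R : realType} {X : pmetricType R}.
Variables (c : X -> cantor_space) (c' : cantor_space -> X).
Hypotheses (cc : continuous c) (cc' : continuous c').
Hypotheses (cK : cancel c c').
Variable alpha : caction G X.
Hypothesis min_alpha : minimal_action alpha.
Hypothesis wm_alpha : topologically_weakly_mixing alpha.

(** An element given by [minimal_visit_mod] for one pair of points works for all nearby pairs, so
    compactness of the square of [X] bounds the exponents. *)
Lemma uniform_visit_mod : exists Lam : nat -> nat -> nat,
  forall n h, (0 < h)%N -> forall x x', exists g,
    [/\ (h%:Z %| e g)%Z, (`|e g| <= Lam n h)%N & cylinder c n x' (alpha g x)].
Proof.
suff H n h : exists L : nat, (0 < h)%N -> forall x x', exists g,
    [/\ (h%:Z %| e g)%Z, (`|e g| <= L)%N & cylinder c n x' (alpha g x)].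
  have [Lam HLam] := choice (fun nh : nat * nat => H nh.1 nh.2).
  by exists (fun n h => Lam (n, h)) => n h; exact: (HLam (n, h)).
have [->|h0] := posnP h; first by exists 0%N.
have cX := coord_compact cc' cK.
have /compact_near_coveringP cXX := compact_setX cX cX.
have := cXX nat \oo (fun L xx => exists g,
    [/\ (h%:Z %| e g)%Z, (`|e g| <= L)%N & cylinder c n xx.2 (alpha g xx.1)]) _.
case=> [[x x'] _ /=|L _ HL]; last first.
  by exists L => _ x x'; exact: (HL L (leqnn L) (x, x')).
have [g [hg Ug]] := minimal_visit_mod eM min_alpha wm_alpha eb x
  (cylinder_open cc n x') (ex_intro _ x' (@cylinder_refl _ c n x')) h0.
exists (alpha g @^-1` cylinder c n x' `*` cylinder c n x',
  [set L | (`|e g| <= L)%N]).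
  split => /=; last by exists `|e g|%N.
  exists (alpha g @^-1` cylinder c n x', cylinder c n x') => //=; split.
    apply: open_nbhs_nbhs; split => //.
    exact/open_act_preimage/cylinder_open.
  by apply: open_nbhs_nbhs; split => //; exact: cylinder_open.
move=> [[z z'] L] /= [[zx zx'] eL]; exists g; split => // i iN.
by rewrite zx// zx'.
Qed.

End UniformVisit.

(** * Recurrence *)

(** Infinitely many disjoint sets of equal positive measure do not fit into a finite measure space:
    the constant series would converge. *)
Lemma measure_recurrence (d : measure_display) (T : measurableType d)
    (R : realType) (m : measure T R) (F : nat -> set T) (a : R) :
  (m setT < +oo)%E -> (0 < a)%R ->
  (forall i, measurable (F i)) -> (forall i, m (F i) = a%:E) ->
  exists i j, (i < j)%N /\ F i `&` F j !=set0.
Proof.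
move=> mT a0 mF mFa; apply: contrapT => H.
have tF : trivIset setT F.
  move=> i j _ _ ij; apply: contrapT => /eqP.
  rewrite neq_ltn => /orP[lt|lt]; apply: H; first by exists i, j.
  by exists j, i; rewrite setIC.
have : cvgn (series (fun _ : nat => a)).
  apply: nnseries_is_cvg => [_|]; first exact: ltW.
  apply: le_lt_trans mT; under eq_eseriesr => i _ do rewrite -(mFa i).
  have := measure_bigcup m setT F (fun i _ => mF i) tF.
  rewrite (eq_eseriesl (Q := xpredT)) => [<-|i]; last by rewrite in_setT.
  apply: le_measure; rewrite ?inE//; exact: bigcup_measurable.
move=> /cvg_series_cvg_0 a_to0.
have a_cst : (fun _ : nat => a) @ \oo --> a by exact: cvg_cst.
have a_eq0 : a = 0%R := cvg_unique (@Rhausdorff R) a_cst a_to0.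
by move: a0; rewrite a_eq0 ltxx.
Qed.

Section InvariantMeasure.
Context {R : realType} {X : pmetricType R}.
Local Notation borel := (g_sigma_algebraType (@open X)).

Lemma open_measurable_borel (U : set X) : open U -> measurable (U : set borel).
Proof. by move=> oU; exact: sub_gen_smallest. Qed.

Context {G : groupType} (alpha : caction G X).
Variable mu : probability borel R.
Hypothesis mu_inv : forall s (A : set borel), measurable A ->
  mu (alpha s @` A) = mu A.
Hypothesis cX : compact [set: X].
Hypothesis min_alpha : minimal_action alpha.

Lemma act_image s (U : set X) : alpha s @` U = alpha s^-1%g @^-1` U.
Proof.
apply/seteqP; split => x /=; first by move=> [y Uy <-]; rewrite actV.
by move=> Ux; exists (alpha s^-1%g x) => //; rewrite actVr.
Qed.

(** By minimality and compactness finitely many translates of [U] cover [X]. *)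
Lemma invariant_open_gt0 (U : set X) : open U -> U !=set0 -> (0 < mu U)%E.
Proof.
move=> oU U0; rewrite lt0e measure_ge0 andbT; apply/eqP => mU0.
have mV g : measurable (alpha g @^-1` U : set borel).
  apply: open_measurable_borel; exact: open_act_preimage.
have mV0 g : mu (alpha g @^-1` U) = 0%E.
  by rewrite -[g]invgK -act_image mu_inv ?mU0//; exact: open_measurable_borel.
have := cX; rewrite compact_cover => /(_ G setT (fun g => alpha g @^-1` U)).
case=> [g _|x _|D _ XD]; first exact: open_act_preimage.
  by have [g Ug] := minimal_visit min_alpha x oU U0; exists g.
have : mu setT = 0%E.
  rewrite (_ : setT = \bigcup_(g in [set` D]) (alpha g @^-1` U)); last first.
    by apply/seteqP; split.
  rewrite bigcup_fset; elim: (enum_fset D) => [|g s IH].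
    by rewrite big_nil measure0.
  rewrite big_cons null_set_setU//.
  exact: (@bigsetU_measurable _ borel G s xpredT _ (fun k _ => mV k)).
  exact: mV0.
by rewrite probability_setT => /eqP; rewrite onee_eq0.
Qed.

(** Recurrence of the rectangle of [A] and [A'] under the diagonal action, for the product measure;
    it yields the same [i] and [j] for both sets. *)
Lemma double_recurrence (A A' : set X) (k : nat -> G) :
  open A -> open A' -> A !=set0 -> A' !=set0 ->
  exists i j, [/\ (i < j)%N, exists x, A (alpha (k i)^-1%g x) /\ A (alpha (k
    j)^-1%g x) &
    exists x, A' (alpha (k i)^-1%g x) /\ A' (alpha (k j)^-1%g x)].
Proof.
move=> oA oA' A0 A'0.
pose F i : set (borel * borel) := (alpha (k i) @` A) `*` (alpha (k i) @` A').
have mF (B : set X) i : open B -> measurable (alpha (k i) @` B : set borel).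
  by move=> oB; rewrite act_image; apply: open_measurable_borel;
    exact: open_act_preimage.
have muE (B : set X) : open B -> mu B = (fine (mu B))%:E.
  by move=> oB; rewrite fineK// fin_num_measure//; exact: open_measurable_borel.
have mu0 (B : set X) : open B -> B !=set0 -> (0 < fine (mu B))%R.
  by move=> oB B0; rewrite -lte_fin -muE//; exact: invariant_open_gt0.
pose m2 : measure (borel * borel)%type R := (mu \x mu)%E.
have m2E (B B' : set borel) : measurable B -> measurable B' ->
    m2 (B `*` B') = (mu B * mu B')%E.
  by move=> mB mB'; exact: product_measure1E.
have [||i|i|i [j [ij [[x y] [[/= ix iy] [/= jx jy]]]]]] :=
  @measure_recurrence _ _ _ m2 F (fine (mu A) * fine (mu A'))%R.
- by rewrite -setXTT m2E// !probability_setT mule1 ltry.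
- by rewrite mulr_gt0// mu0.
- by apply: measurableX; exact: mF.
- rewrite m2E; [|exact: mF..].
  rewrite !mu_inv; [|exact: open_measurable_borel..].
  by rewrite EFinM -!muE.
exists i, j; split => //; [exists x|exists y]; split.
- by case: ix => z Az <-; rewrite actV.
- by case: jx => z Az <-; rewrite actV.
- by case: iy => z Az <-; rewrite actV.
- by case: jy => z Az <-; rewrite actV.
Qed.

End InvariantMeasure.

(** * Products with an integer flow *)

Lemma open_rectangle (X Y : topologicalType) (O : set (X * Y)) xy : open O ->
  O xy ->
  exists U V, [/\ open U, open V, U xy.1, V xy.2 & forall x y, U x -> V y ->
    O (x, y)].
Proof.
move=> oO Oxy; have : nbhs xy O by exact: open_nbhs_nbhs.
move=> [[U V] /= [xU yV] UVO]; exists U°, V°; split.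
- exact: open_interior.
- exact: open_interior.
- exact: xU.
- exact: yV.
- by move=> x y /interior_subset Ux /interior_subset Vy; apply: UVO.
Qed.

(** Each step jumps by [L (k n)], so the differences from all earlier terms lie between [L (k n)]
    and [L (k n) + k n]. *)
Lemma thick_sequence (S : nat -> Prop) :
  (forall r, exists L, forall m, (L <= m <= L + r)%N -> S m) ->
  exists k : nat -> nat, {homo k : i j / (i <= j)%N} /\
    forall i j, (i < j)%N -> S (k j - k i)%N.
Proof.
move=> /choice[L HL]; pose k := fix k n := if n is n'.+1 then (k n' + L (k
  n'))%N else 0%N.
have kS n : k n.+1 = (k n + L (k n))%N by [].
have mk : {homo k : i j / (i <= j)%N}.
  by apply: homo_leq => // [j i l|n]; [exact: leq_trans|rewrite kS leq_addr].
exists k; split => // i [//|j]; rewrite ltnS => ij; apply: (HL (k j)).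
by have := mk _ _ ij; rewrite kS; lia.
Qed.

Section ProductAction.
Context {G : groupType} (e : G -> int).
Hypothesis eM : forall s t, e (s * t)%g = (e s + e t)%R.
Variable b : G.
Hypothesis eb : e b = 1%R.
Context {R : realType} {X : pmetricType R} {Y : topologicalType}.
Variables (tau : int -> Y -> Y).
Hypothesis tau_cont : forall j, continuous (tau j).
Hypothesis tau0 : forall y, tau 0%R y = y.
Hypothesis tauD : forall i j y, tau (i + j)%R y = tau i (tau j y).
Variables (split : X -> X * Y) (join : X * Y -> X).
Hypotheses (splitK : cancel split join) (joinK : cancel join split).
Hypotheses (split_cont : continuous split) (join_cont : continuous join).
Variable alpha : caction G X.

Definition product_act s z := join (alpha s (split z).1, tau (e s) (split z).2).

Lemma product_act_continuous s : continuous (product_act s).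
Proof.
have cx : continuous (fun z => alpha s (split z).1).
  move=> z; have c1 : continuous_at z (fun z => (split z).1).
    exact: (@continuous_comp _ _ _ split fst z (@split_cont z) cvg_fst).
  exact: (@continuous_comp _ _ _ _ (alpha s) z c1 (@act_continuous _ _ alpha s
    _)).
have cy : continuous (fun z => tau (e s) (split z).2).
  move=> z; have c1 : continuous_at z (fun z => (split z).2).
    exact: (@continuous_comp _ _ _ split snd z (@split_cont z) cvg_snd).
  exact: (@continuous_comp _ _ _ _ (tau (e s)) z c1 (@tau_cont _ _)).
move=> z; exact: (@continuous_comp _ _ _ (fun z => (_, _)) join z
  (cvg_pair (cx z) (cy z)) (@join_cont _)).
Qed.

Lemma product_act1 z : product_act 1%g z = z.
Proof.
by rewrite /product_act act1 (hom_int1 eM) tau0 -surjective_pairing splitK.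
Qed.

Lemma product_actM s t z : product_act (s * t)%g z = product_act s (product_act
  t z).
Proof. by rewrite /product_act joinK /= actM eM tauD. Qed.

Definition product_action : caction G X :=
  CAction product_act_continuous product_act1 product_actM.
Local Notation beta := product_action.

Lemma product_actionE s x y : beta s (join (x, y)) = join (alpha s x,
  tau (e s) y).
Proof. by rewrite /= /product_act joinK. Qed.

Lemma hom_int_surj (n : int) : exists g, e g = n.
Proof.
exists (if n is Posz k then b ^+ k else (b ^+ `|n|%N)^-1)%g.
by case: n => n; rewrite ?(hom_intV eM) (hom_intX eM) eb; lia.
Qed.

Lemma join_rectangle (O : set X) x y : open O -> O (join (x, y)) ->
  exists U V, [/\ open U, open V, U x, V y & forall x y, U x -> V y ->
    O (join (x, y))].
Proof.
move=> oO Oxy; apply: (@open_rectangle _ _ (join @^-1` O) (x, y)) => //.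
by apply: open_comp => // z _; exact: join_cont.
Qed.

Lemma product_topologically_free : topologically_free alpha ->
  topologically_free beta.
Proof.
move=> free_alpha O [z Oz] oO; move: Oz; rewrite -[z]splitK;
  case: (split z) => x y.
move=> /(join_rectangle oO)[U [V [oU oV Ux Vy UVO]]].
have [x' [Ux' fx']] := free_alpha U (ex_intro _ x Ux) oU.
exists (join (x', y)); split; first exact: UVO.
move=> s; rewrite product_actionE => /(congr1 split); rewrite !joinK.
by move=> /(congr1 fst); exact: fx'.
Qed.

Variables (c : X -> cantor_space) (c' : cantor_space -> X).
Hypotheses (cc : continuous c) (cc' : continuous c') (cK : cancel c c').
Variable Lam : nat -> nat -> nat.
Hypothesis HLam : forall n h, (0 < h)%N -> forall x x', exists g,
  [/\ (h%:Z %| e g)%Z, (`|e g| <= Lam n h)%N & cylinder c n x' (alpha g x)].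
Hypothesis periodic : forall (P : set Y) n0, open P -> P !=set0 ->
  exists n h, [/\ (n0 <= n)%N, (0 < h)%N & forall y, exists m : int,
    forall i : int, (`|i| <= Lam n h)%N -> P (tau (m + i * h%:Z)%R y)].

(** First [g0] brings the flow to the middle of an [h]-periodic stretch in [V]. Then [g] moves the
    [X]-component into [U]; its exponent is a bounded multiple of [h], so the flow is again in
    [V]. *)
Lemma product_minimal : minimal_action beta.
Proof.
move=> z0 O [z Oz] oO; move: Oz; rewrite -[z]splitK; case: (split z) => x y.
move=> /(join_rectangle oO)[U [V [oU oV Ux Vy UVO]]].
have [n0 n0U] : exists n0, cylinder c n0 x `<=` U.
  by apply: (nbhs_cylinder cc' cK); exact: open_nbhs_nbhs.
have [n [h [n0n h0 per]]] := periodic n0 oV (ex_intro _ y Vy).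
case: (split z0) (splitK z0) => x0 y0 <-; have [m Hm] := per y0.
have [g0 eg0] := hom_int_surj m.
have [g [hg eg gx]] := HLam n h0 (alpha g0 x0) x.
exists (beta (g * g0)%g (join (x0, y0))); split; last by exists (g * g0)%g.
rewrite product_actionE; apply: UVO.
  by apply: n0U => i ii; rewrite actM gx// (leq_trans ii).
have [i ei] := dvdzP hg; rewrite eM eg0 ei addrC; apply: Hm.
by apply: leq_trans eg; rewrite ei abszM leq_pmulr//; lia.
Qed.

Hypothesis thick : forall (P1 P2 P3 P4 : set Y) (r : nat),
  open P1 -> open P2 -> open P3 -> open P4 ->
  P1 !=set0 -> P2 !=set0 -> P3 !=set0 -> P4 !=set0 ->
  exists L : nat, forall m : nat, (L <= m <= L + r)%N ->
    (exists y, P1 y /\ P2 (tau m%:Z%R y)) /\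
    (exists y, P3 y /\ P4 (tau m%:Z%R y)).

(* After one element [s0] has brought the [X]-components together, the return *)
(* times of [alpha] along a sequence of powers of [b] with differences in a   *)
(* thick set of transition times of [tau] take care of the [Y]-components.    *)
Lemma product_weakly_mixing : minimal_action alpha ->
  topologically_weakly_mixing alpha -> has_invariant_probability alpha ->
  topologically_weakly_mixing beta.
Proof.
move=> min_alpha wm_alpha [mu mu_inv] O1 O2 O3 O4 oO1 oO2 oO3 oO4.
move=> [z1 +] [z2 +] [z3 +] [z4 +].
rewrite -[z1]splitK -[z2]splitK -[z3]splitK -[z4]splitK.
case: (split z1) => x1 y1; case: (split z2) => x2 y2.
case: (split z3) => x3 y3; case: (split z4) => x4 y4.
move=> /(join_rectangle oO1)[U1 [V1 [oU1 oV1 Ux1 Vy1 UVO1]]].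
move=> /(join_rectangle oO2)[U2 [V2 [oU2 oV2 Ux2 Vy2 UVO2]]].
move=> /(join_rectangle oO3)[U3 [V3 [oU3 oV3 Ux3 Vy3 UVO3]]].
move=> /(join_rectangle oO4)[U4 [V4 [oU4 oV4 Ux4 Vy4 UVO4]]].
have [s0 [[_ [[u1 Uu1 <-] Usu1]] [_ [[u3 Uu3 <-] Usu3]]]] := wm_alpha _ _ _ _
  oU1 oU2 oU3 oU4 (ex_intro _ _ Ux1) (ex_intro _ _ Ux2) (ex_intro _ _ Ux3)
  (ex_intro _ _ Ux4).
pose A := U1 `&` alpha s0 @^-1` U2; pose A' := U3 `&` alpha s0 @^-1` U4.
have oA : open A by apply: openI => //; exact: open_act_preimage.
have oA' : open A' by apply: openI => //; exact: open_act_preimage.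
pose W2 := tau (e s0) @^-1` V2; pose W4 := tau (e s0) @^-1` V4.
have oW2 : open W2 by apply: open_comp => // y _; exact: tau_cont.
have oW4 : open W4 by apply: open_comp => // y _; exact: tau_cont.
have tauK i y : tau i (tau (- i)%R y) = y by rewrite -tauD addrN tau0.
have W20 : W2 !=set0 by exists (tau (- e s0)%R y2); rewrite /W2 /= tauK.
have W40 : W4 !=set0 by exists (tau (- e s0)%R y4); rewrite /W4 /= tauK.
have [k [mk Sk]] := thick_sequence (fun r => thick r oV1 oW2 oV3 oW4
  (ex_intro _ _ Vy1) W20 (ex_intro _ _ Vy3) W40).
have cX := coord_compact cc' cK.
(* The points [b ^+ k i] applied to [x] and [x'] lie in [A] and [A'], and return there after
   [b ^+ (k j - k i)]; then [s0] leads to [U2] and [U4]. *)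
have [i [j [ij [x [Axi Axj]] [x' [A'xi A'xj]]]]] :=
  double_recurrence mu_inv cX min_alpha (fun i => (b ^+ k i)^-1)%g oA oA'
    (ex_intro _ u1 (conj Uu1 Usu1)) (ex_intro _ u3 (conj Uu3 Usu3)).
move: Axi Axj A'xi A'xj; rewrite !invgK => Axi Axj A'xi A'xj.
have [[y [Vy Wy]] [y' [Vy' Wy']]] := Sk i j ij.
have kij := mk _ _ (ltnW ij).
have bE z : alpha (b ^+ (k j - k i))%g (alpha (b ^+ k i)%g z) = alpha (b ^+ k
  j)%g z.
  by rewrite -actM -expgnDr subnK.
have bX : e (b ^+ (k j - k i))%g = (k j - k i)%N%:Z%R.
  by rewrite (hom_intX eM) eb; lia.
exists (s0 * b ^+ (k j - k i))%g; split.
  exists (beta (s0 * b ^+ (k j - k i))%g (join (alpha (b ^+ k i)%g x, y))).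
  split; first by exists (join (alpha (b ^+ k i)%g x, y)) => //;
    apply: UVO1 => //; case: Axi.
  rewrite product_actionE eM bX tauD actM bE; apply: UVO2 => //.
  by case: Axj.
exists (beta (s0 * b ^+ (k j - k i))%g (join (alpha (b ^+ k i)%g x', y'))).
split; first by exists (join (alpha (b ^+ k i)%g x', y')) => //;
  apply: UVO3 => //; case: A'xi.
rewrite product_actionE eM bX tauD actM bE; apply: UVO4 => //.
by case: A'xj.
Qed.

End ProductAction.

(** * Measures from clopen contents *)

Section ProbabilityOfMeasure.
Context d (T : measurableType d) (R : realType) (nu : measure T R).
Hypothesis nuT : nu setT = 1%E.

Definition unit_measure of nu setT = 1%E : set T -> \bar R := nu.
HB.instance Definition _ := Measure.on (unit_measure nuT).
HB.instance Definition _ :=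
  Measure_isProbability.Build _ _ _ (unit_measure nuT) nuT.

Definition probability_of_measure : probability T R := unit_measure nuT.

End ProbabilityOfMeasure.

(** A copy of [X] whose measurable sets are the clopen sets, kept apart from the Borel structure. *)
Definition clopen_algebra (X : ptopologicalType) : Type := X.
HB.instance Definition _ (X : ptopologicalType) :=
  Pointed.on (clopen_algebra X).

Lemma clopen_setC_closed (X : ptopologicalType) : setC_closed (@clopen X).
Proof. by move=> A; exact: clopenC. Qed.

HB.instance Definition _ (X : ptopologicalType) :=
  @isAlgebraOfSets.Build default_measure_display (clopen_algebra X)
    (@clopen X) clopen0 (@clopenU X) (@clopen_setC_closed X).

Section ClopenContent.
Context {R : realType} {X : pmetricType R}.
Local Notation borel := (g_sigma_algebraType (@open X)).
Variable m : set X -> R.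
Hypothesis m_ge0 : forall A, (0 <= m A)%R.
Hypothesis mT : m setT = 1%R.
Hypothesis mU : forall A B, clopen A -> clopen B -> A `&` B = set0 ->
  m (A `|` B) = (m A + m B)%R.
Hypothesis cX : compact [set: X].
Hypothesis base : forall (U : set X) x, open U -> U x ->
  exists V, [/\ clopen V, V x & V `<=` U].

Lemma clopen_content0 : m set0 = 0%R.
Proof.
apply: (@addrI _ (m set0)); rewrite addr0.
by rewrite -(mU clopen0 clopen0) ?setU0 ?setI0.
Qed.

Lemma clopen_content_bigsetU (F : nat -> set X) n : (forall i, clopen (F i)) ->
  trivIset setT F ->
  clopen (\big[setU/set0]_(i < n) F i) /\
  m (\big[setU/set0]_(i < n) F i) = (\sum_(0 <= i < n) m (F i))%R.
Proof.
move=> cF tF; elim: n => [|n [cU IH]].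
  by rewrite big_ord0 big_geq//; split; [exact: clopen0|exact: clopen_content0].
rewrite big_ord_recr /= big_nat_recr//= -IH; split; first exact: clopenU.
apply: mU => //; apply/seteqP; split => // x [+ Fnx].
rewrite -bigcup_mkord => -[i /= iN Fix].
have := tF i n I I (ex_intro _ x (conj Fix Fnx)) => E.
by move: iN; rewrite E ltnn.
Qed.

(** By compactness a clopen union of clopen sets is already a finite union, so finite additivity
    suffices. *)
Lemma clopen_content_sigma_additive :
  @semi_sigma_additive _ R (clopen_algebra X) (fun A => (m A)%:E).
Proof.
move=> F cF tF cU.
have cptU : compact (\bigcup_n F n : set X).
  by apply: subclosed_compact cX _ => //; case: cU.
move: cptU; rewrite compact_cover => /(_ nat setT F).
case=> [i _|x //|D _ UD]; first by case: (cF i).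
pose N := (\max_(i <- enum_fset D) i).+1.
apply: cvg_near_cst; exists N => // n /= Nn.
have [_] := clopen_content_bigsetU n cF tF; rewrite sumEFin => <-;
  congr (m _)%:E.
apply/seteqP; split => x; first by rewrite -bigcup_mkord => -[i _ Fix];
  exists i.
move=> /UD[i iD Fix]; rewrite -bigcup_mkord; exists i => //=.
apply: leq_trans Nn; rewrite ltnS; exact: (@leq_bigmax_seq _ _ xpredT id i iD).
Qed.

(** There are only countably many clopen sets and they form a base, so every open set is a countable
    union of them. *)
Lemma sigma_clopen : <<s (@clopen X) >> = <<s (@open X) >>.
Proof.
apply/seteqP; split; last first.
  apply: smallest_sub; first exact: smallest_sigma_algebra.
  move=> U oU.
  have [f] := clopen_surj cX.
  have -> : U = \bigcup_n (if pselect (f n `<=` U) then f n else set0).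
    apply/seteqP; split => x; last by move=> [n _]; case: pselect => //= fU;
      exact: fU.
    move=> Ux; have [V [cV Vx VU]] := base oU Ux.
    have [n _ fn] := @surj _ _ _ _ f _ cV; exists n => //.
    by case: pselect => //; rewrite fn.
  apply: sigma_algebra_bigcup => n; case: pselect => [fU|nfU] /=.
    by apply: sub_gen_smallest; exact: funS.
  exact: sigma_algebra0.
apply: sub_smallest2r; first exact: smallest_sigma_algebra.
by move=> U [].
Qed.

(** This is the Carathéodory extension. Pulling back a clopen cover preserves its total mass, so
    outer measure cannot increase under preimages by [f] or by [g]; together they give equality. *)
Lemma clopen_content_extension : exists nu : probability borel R,
  (forall A, clopen A -> nu A = (m A)%:E) /\
  (forall f g : X -> X, cancel f g -> cancel g f -> continuous f ->
    continuous g ->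
    (forall A, clopen A -> m (f @^-1` A) = m A) ->
    (forall A, clopen A -> m (g @^-1` A) = m A) ->
    forall A, nu (f @` A) = nu A).
Proof.
pose mu0 : set (clopen_algebra X) -> \bar R := fun A => (m A)%:E.
have mu00 : mu0 set0 = 0%E by rewrite /mu0 clopen_content0.
have mu0_ge0 A : (0 <= mu0 A)%E by rewrite lee_fin.
pose M : measure (clopen_algebra X) R := HB.pack mu0
  (isMeasure.Build _ _ _ mu0 mu00 mu0_ge0 clopen_content_sigma_additive).
pose ext : set borel -> \bar R := mu_ext M.
have ext0 : ext set0 = 0%E by exact: (mu_ext0 (measure0 M) (measure_ge0 M)).
have ext_ge0 A : (0 <= ext A)%E by exact: (mu_ext_ge0 (measure_ge0 M)).
have ext_add : semi_sigma_additive ext.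
  move=> F mF tF mUF.
  have mE (A : set X) : measurable (A : set borel) ->
      measurable (A : set (g_sigma_algebraType (@measurable _ (clopen_algebra
        X)))).
    by rewrite /measurable /= -sigma_clopen.
  apply: (@measure_semi_sigma_additive _ _ _ (measure_extension M) F) => //.
    by move=> i; exact: mE.
  exact: mE.
have extE (A : set X) : clopen A -> ext A = (m A)%:E.
  by move=> cA; exact: (@measurable_mu_extE _ _ (clopen_algebra X) M A cA).
have extT : ext setT = 1%E by rewrite (extE setT clopenT) mT.
pose nu : measure borel R := HB.pack ext
  (isMeasure.Build _ _ _ ext ext0 ext_ge0 ext_add).
exists (probability_of_measure (extT : nu setT = 1%E));
  split => [A cA|f g fK gK cf cg mf mg A]; first exact: extE.
have le (h h' : X -> X) (B : set X) : continuous h ->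
    (forall A, clopen A -> m (h @^-1` A) = m A) ->
    (mu_ext M (h @^-1` B : set (clopen_algebra X)) <= mu_ext M B)%E.
  move=> ch mh; apply/le_ereal_inf_tmp => _ [F [cF BF] <-].
  apply: ereal_inf_lbound; exists (fun k => h @^-1` F k).
    split; first by move=> i; exact: preimage_clopen (cF i) ch.
    by move=> x /BF[i _ Fi]; exists i.
  by apply: eq_eseriesr => i _; rewrite /= /mu0 mh//; exact: cF.
have fA : f @` A = g @^-1` A.
  apply/seteqP; split => x /=; first by move=> [y Ay <-]; rewrite fK.
  by move=> Ax; exists (g x).
apply/eqP; rewrite eq_le fA; apply/andP; split; first exact: (le g).
have := le f f (g @^-1` A) cf mf; congr (mu_ext M _ <= _)%E.
by apply/seteqP; split => x /=; rewrite fK.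
Qed.

End ClopenContent.

(** * An invariant mean on the integers *)

Section InvariantMean.
Variable R : realType.
Local Open Scope ring_scope.
Implicit Types phi psi : int -> R.

Definition unit_bounded phi := forall i, 0 <= phi i <= 1.

(** [harmonic n] is the inverse of [n + 1], so this is an average. *)
Definition cesaro phi (n : nat) : R := (\sum_(0 <= i < n.+1) phi i%:Z) *
  harmonic n.

Lemma cesaro_bounded phi n : unit_bounded phi -> 0 <= cesaro phi n <= 1.
Proof.
move=> bphi; have h0 : (0 : R) <= harmonic n by exact: harmonic_ge0.
apply/andP; split.
  by rewrite mulr_ge0// sumr_ge0// => i _; case/andP: (bphi i%:Z).
have -> : (1 : R) = (\sum_(0 <= i < n.+1) 1) * harmonic n.
  by rewrite big_const_nat iter_addr addr0 subn0 -[_ *+ _]/(_%:R) divff//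
    pnatr_eq0.
by rewrite ler_wpM2r// ler_sum// => i _; case/andP: (bphi i%:Z).
Qed.

Lemma ultra_bounded_cvg (F : set_system nat) (r : nat -> R) : UltraFilter F ->
  (forall n, 0 <= r n <= 1) -> exists l : R, r @ F --> l.
Proof.
move=> FU br; have FF : ProperFilter F by exact: ultra_proper.
have [|p [_ clp]] := @segment_compact R 0 1 (r @ F) _.
  by apply: nearW => n; rewrite /= in_itv /=.
exists p => U pU; have [//|FnU] := in_ultra_setVsetC (r @^-1` U) FU.
have [x [/= nUx Ux]] := clp (~` U) U FnU pU.
by case: nUx.
Qed.

(* Banach limit along an ultrafilter.                                         *)
Lemma invariant_mean_exists : exists L : (int -> R) -> R,
  [/\ forall phi, unit_bounded phi -> 0 <= L phi,
      forall phi psi, unit_bounded phi -> unit_bounded psi ->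
        L (fun i => phi i + psi i) = L phi + L psi,
      L (fun=> 1) = 1 &
      forall phi k, unit_bounded phi -> L (fun i => phi (i + k)) = L phi].
Proof.
have [F [FU ooF]] := @ultraFilterLemma nat \oo _.
have FF : ProperFilter F by exact: ultra_proper.
pose L phi := lim (cesaro phi @ F).
have cvgL phi : unit_bounded phi -> cesaro phi @ F --> L phi.
  move=> bphi; have [|l cl] := @ultra_bounded_cvg F (cesaro phi) FU.
    by move=> n; exact: cesaro_bounded.
  by apply/cvg_ex; exists l.
have LE phi l : cesaro phi @ F --> l -> L phi = l by move=> /cvg_lim; apply.
have L1 phi : unit_bounded phi -> L (fun i => phi (i + 1)) = L phi.
  move=> bphi; apply: LE.
  (* A unit shift changes the average only by a boundary term, which tends to 0. *)
  have -> : cesaro (fun i => phi (i + 1)) =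
      (fun n => cesaro phi n + (phi n.+1%:Z - phi 0) * harmonic n).
    apply/funext => n; rewrite /cesaro -mulrDl; congr (_ * _).
    rewrite big_nat_recr//= [in RHS]big_nat_recl//= [RHS]addrC addrA addrNK.
    rewrite [RHS]addrC; congr (_ + _); last by congr phi; lia.
    by apply: eq_bigr => i _; congr phi; lia.
  rewrite -[X in _ --> X]addr0; apply: cvgD; first exact: cvgL.
  apply: (@squeeze_cvgr _ _ _ _ (fun n => - harmonic n) (@harmonic R)).
  - apply: nearW => n; have h0 : (0 : R) <= harmonic n by exact: harmonic_ge0.
    have /andP[a0 a1] := bphi n.+1%:Z; have /andP[b0 b1] := bphi 0.
    have dm : -1 <= phi n.+1%:Z - phi 0 by lra.
    have dp : phi n.+1%:Z - phi 0 <= 1 by lra.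
    apply/andP; split; first by rewrite -mulN1r ler_wpM2r.
    by rewrite -[leRHS]mul1r ler_wpM2r.
  - rewrite -oppr0; apply: cvgN; apply: cvg_trans (@cvg_harmonic R).
    exact: cvg_app ooF.
  - apply: cvg_trans (@cvg_harmonic R); exact: cvg_app ooF.
exists L; split.
- move=> phi bphi; apply: limr_ge; first by apply/cvg_ex; eexists; exact: cvgL.
  by apply: nearW => n; case/andP: (cesaro_bounded n bphi).
- move=> phi psi bphi bpsi; apply: LE.
  have -> : cesaro (fun i => phi i + psi i) = cesaro phi + cesaro psi.
    by apply/funext => n; rewrite /cesaro big_split /= mulrDl.
  by apply: cvgD; exact: cvgL.
- apply: LE; rewrite (_ : cesaro _ = fun=> 1); first exact: cvg_cst.
  apply/funext => n; rewrite /cesaro big_const_nat iter_addr addr0 subn0.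
  by rewrite -[_ *+ _]/(_%:R) divff// pnatr_eq0.
- move=> phi k bphi; have pos (n : nat) psi : unit_bounded psi ->
      L (fun i => psi (i + n%:Z)) = L psi.
    elim: n psi => [|n IH] psi bpsi.
      by congr L; apply/funext => i; rewrite addr0.
    rewrite -(L1 _ bpsi) -(IH (fun i => psi (i + 1))); last by move=> i;
      exact: bpsi.
    by congr L; apply/funext => i; congr psi; lia.
  case: k => n; first exact: pos.
  rewrite -(pos n.+1 (fun i => phi (i + Negz n))); last by move=> i;
    exact: bphi.
  by congr L; apply/funext => i; congr phi; lia.
Qed.

End InvariantMean.

(** * An invariant probability for the product action *)

Section ProductInvariantProbability.
Context {G : groupType} (e : G -> int) {R : realType} {X : pmetricType R}.
Context {Y : topologicalType} (tau : int -> Y -> Y).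
Hypothesis tauD : forall i j y, tau (i + j)%R y = tau i (tau j y).
Variable join : X * Y -> X.
Hypothesis join_cont : continuous join.
Variables (alpha beta : caction G X) (y0 : Y).
Hypothesis betaE : forall s x y,
  beta s (join (x, y)) = join (alpha s x, tau (e s) y).
Hypothesis cX : compact [set: X].
Hypothesis base : forall (U : set X) x, open U -> U x ->
  exists V, [/\ clopen V, V x & V `<=` U].
Local Notation borel := (g_sigma_algebraType (@open X)).

Lemma product_invariant_probability :
  has_invariant_probability alpha -> has_invariant_probability beta.
Proof.
move=> [mu mu_inv]; have [L [L0 LD L1 LS]] := invariant_mean_exists R.
pose slice (E : set X) y := [set x | E (join (x, y))].
pose phi (E : set X) i : R := fine (mu (slice E (tau i y0))).
have cslice E y : clopen E -> clopen (slice E y).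
  move=> cE; apply: (@preimage_clopen _ _ (fun x => join (x, y))) => // x.
  apply: (@continuous_comp _ _ _ (fun x => (x, y)) join); last exact: join_cont.
  by apply: cvg_pair; [exact: cvg_id|exact: cvg_cst].
have mslice E y : clopen E -> measurable (slice E y : set borel).
  by move=> /cslice-/(_ y)[oE _]; exact: open_measurable_borel.
have fmu E y : clopen E -> mu (slice E y) \is a fin_num.
  by move=> cE; apply: fin_num_measure; exact: mslice.
have bphi E : clopen E -> unit_bounded (phi E).
  move=> cE i; rewrite fine_ge0 ?measure_ge0//= -lee_fin fineK ?fmu//.
  by apply: probability_le1; exact: mslice.
(* The absolute value makes [m] nonnegative on all sets; on clopen sets it changes nothing. *)
pose m (E : set X) : R := `|L (phi E)|%R.
have mE E : clopen E -> m E = L (phi E).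
  by move=> cE; rewrite /m ger0_norm//; exact/L0/bphi.
have mU A B : clopen A -> clopen B -> A `&` B = set0 ->
  m (A `|` B) = (m A + m B)%R.
  move=> cA cB AB0; rewrite !mE//; last exact: clopenU.
  rewrite -LD; [|exact: bphi..]; congr L; apply/funext => i.
  rewrite /phi -fineD ?fmu// -measureU ?mslice//; [exact: mslice..|].
  by apply/seteqP; split => // x [Ax Bx]; have := conj Ax Bx;
    rewrite -[_ /\ _]/((A `&` B) _) AB0.
(* Invariance of [mu] turns the preimage under [beta s] into a shift of [phi A] by [e s], which [L]
   ignores. *)
have mB s A : clopen A -> m (beta s @^-1` A) = m A.
  move=> cA; rewrite !mE//; last exact: preimage_clopen cA (@act_continuous _ _
    beta s).
  rewrite -[RHS](LS _ (e s)); last exact: bphi.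
  congr L; apply/funext => i; rewrite /phi; congr fine.
  rewrite -[RHS](mu_inv s^-1%g); last exact: mslice.
  rewrite act_image invgK; congr (mu _); apply/seteqP; split => x /=.
    by rewrite /slice /= betaE -tauD addrC.
  by rewrite /slice /= betaE -tauD addrC.
have mT : m setT = 1%R.
  rewrite mE; last exact: clopenT.
  rewrite (_ : phi setT = fun=> 1%R) ?L1//; apply/funext => i.
  by rewrite /phi (_ : slice _ _ = setT)// probability_setT.
have [nu [nuE nuI]] := clopen_content_extension (fun A => normr_ge0 (L (phi A)))
  mT mU cX base.
exists nu => s A mA; apply: (nuI (beta s) (beta s^-1%g)).
- by move=> x; rewrite actV.
- by move=> x; rewrite actVr.
- exact: act_continuous.
- exact: act_continuous.
- exact: mB.
- exact: mB.
Qed.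

End ProductInvariantProbability.

(** * Topology of the space of actions *)

Section ActionTopology.
Context {R : realType} {G : groupType} {X : metricType R}.
Implicit Types (alpha beta : caction G X).

Lemma nbhs_act_ball alpha (U : set (caction G X)) : nbhs alpha U ->
  exists (E : {fset G}) (delta : R), (0 < delta)%R /\ act_ball alpha E delta
    `<=` U.
Proof.
move=> [V [[I ID <-] [i Ii Vi] VU]].
have [e e0 He] := act_ball_nbhs Vi; exists i.1.2, e; split => // beta Hb.
by apply: VU; exists i => //; exact: He.
Qed.

Lemma act_ball_is_nbhs alpha (E : {fset G}) (delta : R) : (0 < delta)%R ->
  nbhs alpha (act_ball alpha E delta).
Proof.
move=> d0; exists (act_ball alpha E delta); split => //;
  last exact: act_ball_center.
exists [set (alpha, E, delta)]; first by move=> _ ->.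
by rewrite bigcup_set1.
Qed.

Lemma act_ball_mdist alpha beta (E : {fset G}) delta s x :
  act_ball alpha E delta beta -> s \in E -> (mdist (beta s x) (alpha s x) <
    delta)%R.
Proof.
move=> ab sE; rewrite -lte_fin; apply: le_lt_trans (ab s sE).
by apply: ereal_sup_ubound; exists x.
Qed.

Lemma mdist_lt_nbhs (x : X) (r : R) : (0 < r)%R ->
  nbhs x [set y | (mdist x y < r)%R].
Proof. by move=> r0; rewrite -ballEmdist; exact: nbhsx_ballx. Qed.

Lemma nbhs_mdist (x : X) U : nbhs x U ->
  exists2 r : R, (0 < r)%R & forall y, (mdist x y < r)%R -> U y.
Proof.
move=> /nbhs_ballP[r /= r0 rU]; exists r => // y xy; apply: rU.
by rewrite ballEmdist.
Qed.

Lemma clopen_uniform (B : set X) : compact [set: X] -> clopen B ->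
  exists2 r : R, (0 < r)%R & forall x y, (mdist y x < r)%R -> B y <-> B x.
Proof.
move=> cX [oB cB].
have side x : \forall y \near x, B y <-> B x.
  have [Bx|nBx] := pselect (B x).
    by have := open_nbhs_nbhs (conj oB Bx); apply: filterS => y By.
  have := open_nbhs_nbhs (conj (closed_openC cB) nBx); apply: filterS => y nBy.
  by split => // /nBy.
have /compact_near_coveringP cX' := cX.
pose Q (r : R) (x : X) := forall y, (mdist y x < r)%R -> B y <-> B x.
suff H : \forall r \near (0^'+)%R, [set: X] `<=` Q r.
  have [r [r0 Hr]] := filter_ex (filterI (nbhs_right_gt (0 : R)%R) H).
  by exists r => // x y; exact: Hr.
apply: cX' => x _.
have [r r0 rB] := nbhs_mdist (side x).
have r20 : (0 < r / 2)%R by rewrite divr_gt0.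
exists ([set y | (mdist x y < r / 2)%R], [set t | (t < r / 2)%R]).
  by split; [exact: mdist_lt_nbhs|exact: nbhs_right_lt].
move=> [z t] /= [xz tr] y yz.
have By : B y <-> B x.
  apply: rB; apply: le_lt_trans (metric_triangle x z y) _.
  by rewrite [r]splitr ltrD// (metric_sym z) (lt_trans yz).
have Bz : B z <-> B x by apply: rB; apply: lt_le_trans xz _;
  rewrite ler_pdivrMr//; lra.
by split => [/By/Bz|/Bz/By].
Qed.

End ActionTopology.

(** * Splitting invariant clopen sets *)

Section Splitting.
Context {R : realType} {G : groupType} {X : pmetricType R}.
Implicit Types (alpha beta : caction G X) (A B : set X).

Definition invariant beta (a : G) A := forall x, A (beta a x) <-> A x.

Definition splits beta a A := exists B,
  [/\ clopen B, invariant beta a B, B `<=` A, B !=set0 & A `\` B !=set0].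

(** Membership in a clopen set survives small displacements. Hence the same [B] splits [A] for
    nearby actions, or [A] remains non-invariant for them. *)
Lemma splits_open alpha a A : compact [set: X] -> clopen A ->
  (invariant alpha a A -> splits alpha a A) ->
  exists (E : {fset G}) (delta : R), (0 < delta)%R /\
    forall beta, act_ball alpha E delta beta ->
      invariant beta a A -> splits beta a A.
Proof.
move=> cX cA H; exists [fset a]%fset.
have aE : a \in [fset a]%fset by rewrite inE.
have [/H[B [cB iB BA B0 AB0]]|niA] := pselect (invariant alpha a A).
  have [r r0 rB] := clopen_uniform cX cB; exists r; split => // beta ab _.
  exists B; split => // x; rewrite -(iB x); apply: rB.
  exact: act_ball_mdist ab aE.
have [r r0 rA] := clopen_uniform cX cA; exists r; split => // beta ab iA.
exfalso; apply: niA => x; rewrite -(iA x); apply: iff_sym; apply: rA.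
exact: act_ball_mdist ab aE.
Qed.

(* Iterating the splitting gives a binary tree of invariant clopen sets, whose *)
(* branches are read off by the factor map.                                   *)
Lemma splits_factors_onto alpha a : compact [set: X] ->
  (forall A, clopen A -> invariant alpha a A -> A !=set0 -> splits alpha a A) ->
  factors_onto (restrict_cyclic alpha a)
    (trivial_action (cyclic_subgroup a) cantor_space).
Proof.
move=> cX H.
have /choice[half Hhalf] : forall A, exists B, clopen A ->
  invariant alpha a A ->
    A !=set0 -> [/\ clopen B, invariant alpha a B, B `<=` A,
      B !=set0 & A `\` B !=set0].
  move=> A; have [[cA iA A0]|nA] := pselect [/\ clopen A,
    invariant alpha a A & A !=set0].
    by have [B HB] := H A cA iA A0; exists B.
  by exists A => cA iA A0; exfalso; apply: nA.
(* [node w] descends the tree along [w]; [run x] below descends along the nodes that contain [x]. *)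
pose node (w : nat -> bool) := fix node n := if n is m.+1 then
  (if w m then half (node m) else node m `\` half (node m)) else [set: X].
have nodeP w n : [/\ clopen (node w n), invariant alpha a (node w n)
  & node w n !=set0].
  elim: n => [|n [c i n0]] /=; first by split => //;
    [exact: clopenT|exists point].
  have [cB iB BA B0 AB0] := Hhalf _ c i n0; case: (w n) => //; split => //.
    by rewrite setDE; apply: clopenI => //; exact: (clopenC set0 cB).
  by move=> x; have := i x; have := iB x; rewrite /setD /=; tauto.
have node_ext w w' n : (forall i, (i < n)%N -> w i = w' i) ->
  node w n = node w' n.
  elim: n => //= n IH ww; rewrite ww// IH// => i im; apply: ww.
  exact: ltnW.
pose step x (An : set X) : bool * set X := let b := `[< half An x >] in
  (b, if b then half An else An `\` half An).
pose run x := fix run n := if n is m.+1 then (step x (run m)).2 else [set: X].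
pose f x : cantor_space := fun n => (step x (run x n)).1.
have runE x n : run x n = node (f x) n.
  elim: n => //= n IH; rewrite -IH /f /step /=; by case: asboolP.
have inrun x n : run x n x.
  elim: n => //= n IH; rewrite /step /=; case: asboolP => //.
have fE w x n : node w n x -> forall i, (i < n)%N -> f x i = w i.
  elim: n => // n IH /= Hx.
  have nx : node w n x.
    have [c i n0] := nodeP w n; have [_ _ BA _ _] := Hhalf _ c i n0.
    by move: Hx; case: (w n) => [/BA|[]].
  have IHn := IH nx => i; rewrite ltnS leq_eqVlt => /predU1P[->|];
    last exact: IHn.
  rewrite /f runE (node_ext _ w) => [|k kn]; last exact: IHn.
  rewrite /step /=; move: Hx; case: (w n) => [hx|[_ hx]].
    exact: asboolT.
  exact: asboolF.
have fnode x y n : node (f x) n y -> forall i, (i < n)%N -> f y i = f x i.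
  exact: fE.
exists f; split.
- apply: (@continuous_prod nat (fun=> bool)) => i x U fxU.
  have [[oN _] _ _] := nodeP (f x) i.+1.
  have : nbhs x (node (f x) i.+1).
    by apply: open_nbhs_nbhs; split => //; rewrite -runE.
  apply: filterS => y /fnode/(_ i (leqnn _)) yx.
  by rewrite /= yx; exact: nbhs_singleton.
- move=> w; suff [x Hx] : (\bigcap_n node w n) !=set0.
    exists x; apply/funext => i.
    exact: (fE w x i.+1 (Hx i.+1 Logic.I) i (leqnn _)).
  have dec m n : (m <= n)%N -> node w n `<=` node w m.
    elim: n => [|n IH]; first by rewrite leqn0 => /eqP ->.
    rewrite leq_eqVlt => /predU1P[->//|/IH nm]; apply: subset_trans nm => /=.
    have [c i n0] := nodeP w n; have [_ _ BA _ _] := Hhalf _ c i n0.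
    by case: (w n) => // x [].
  have := cX; rewrite compact_In0 => /(_ nat setT (node w)); apply.
    exists (node w) => [i _|i _]; last by rewrite setTI.
    by case: (nodeP w i) => -[].
  move=> D _; pose N := (\max_(i <- enum_fset D) i)%N.
  have [_ _ [x Nx]] := nodeP w N; exists x => i /= iD; apply: dec Nx.
  exact: (@leq_bigmax_seq _ _ xpredT id i iD).
- move=> s x; suff fa y : f (alpha a y) = f y.
    have faX n y : f (alpha (a ^+ n)%g y) = f y.
      elim: n y => [|n IH] y; first by rewrite expg0 act1.
      by rewrite expgS actM fa IH.
    case: s => g /= /asboolP[n [->|->]]; first exact: faX.
    by rewrite -(faX n) actVr.
  have runa n : run (alpha a y) n = run y n /\ f (alpha a y) n = f y n.
    have key m : run (alpha a y) m = run y m -> f (alpha a y) m = f y m.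
      move=> E; rewrite /f E /step /=; have [c i n0] := nodeP (f y) m.
      have [_ iB _ _ _] := Hhalf _ c i n0.
      by apply: asbool_equiv_eq; rewrite runE; exact: iB.
    elim: n => [|n [IH _]]; first by split => //; exact: key.
    have E : run (alpha a y) n.+1 = run y n.+1.
      by have := key n IH; rewrite /= /f IH /step /= => ->.
    by split => //; exact: key.
  by apply/funext => n; have [] := runa n.
Qed.

End Splitting.

(** * Density *)

Section Density.
Context {R : realType} {X : pmetricType R} {d : nat}.
Local Notation G := (free_group d).
Variables (c : X -> cantor_space) (c' : cantor_space -> X).
Hypotheses (cc : continuous c) (cc' : continuous c').
Hypotheses (cK : cancel c c') (c'K : cancel c' c).

Lemma cylinder_leq m n x : (m <= n)%N -> cylinder c n x `<=` cylinder c m x.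
Proof. by move=> mn y yx i im; apply: yx; exact: leq_trans im mn. Qed.

Lemma cylinder_mdist (f : X -> X) (r : R) : continuous f -> (0 < r)%R ->
  exists n, forall x y, cylinder c n x y -> (mdist (f y) (f x) < r)%R.
Proof.
move=> cf r0; apply: (cylinder_uniform cc cc' cK
  (P := fun x y => (mdist (f y) (f x) < r)%R)) => x.
have r20 : (0 < r / 2)%R by rewrite divr_gt0.
exists (f @^-1` [set y | (mdist (f x) y < r / 2)%R]).
  by apply: cf; exact: mdist_lt_nbhs.
move=> y z /= xy xz; apply: le_lt_trans (metric_triangle _ (f x) _) _.
by rewrite [r]splitr ltrD// metric_sym.
Qed.

Lemma cylinder_clopen A : clopen A ->
  exists n, forall x y, cylinder c n x y -> A x <-> A y.
Proof.
move=> [oA cA]; apply: (cylinder_uniform cc cc' cK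
  (P := fun x y => A x <-> A y)) => x.
have [Ax|nAx] := pselect (A x).
  by exists A; [exact: open_nbhs_nbhs|move=> y z Ay Az; split].
exists (~` A); last by move=> y z nAy nAz; split.
by apply: open_nbhs_nbhs; split => //; exact: closed_openC.
Qed.

Lemma coord_clopen i : clopen [set y : cantor_space | y i = true].
Proof.
apply: (@preimage_clopen _ _ (fun y : cantor_space => y i : bool) [set true]).
  by split; [exact: discrete_open|exact: discrete_closed].
exact: cantor_coord_continuous.
Qed.

Lemma clopen_base (U : set X) x : open U -> U x ->
  exists V, [/\ clopen V, V x & V `<=` U].
Proof.
move=> oU Ux; have [|n nU] := @nbhs_cylinder _ _ _ cc' cK x U.
  exact: open_nbhs_nbhs.
exists (cylinder c n x); split => //; split; first exact: cylinder_open.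
move=> y /(_ (cylinder c n y) (open_nbhs_nbhs (conj (cylinder_open cc n y)
  (@cylinder_refl _ c n y))))[z [zx zy]].
by move=> i ii; rewrite -zy// zx.
Qed.

(** Exponents are counted for a second generator [j], so the flow coordinate is fixed by [a_k] and
    any clopen condition on it is invariant. *)
Lemma splits_dense (alpha : caction G X) (k : 'I_d) (E : {fset G}) (delta : R)
    (A : set X) :
  (2 <= d)%N -> WA alpha -> (0 < delta)%R -> clopen A -> A !=set0 ->
  exists beta, [/\ WA beta, act_ball alpha E delta beta &
    invariant beta (fg_gen k) A -> splits beta (fg_gen k) A].
Proof.
move=> d2 [min_alpha free_alpha wm_alpha mu_alpha] delta0 cA [a0 Aa0].
have [j jk] : exists j : 'I_d, j != k.
  case: (eqVneq (Ordinal (ltnW d2)) k) => [k0|];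
    last by exists (Ordinal (ltnW d2)).
  by exists (Ordinal d2); rewrite -k0.
pose e := @exponent_sum d j; have eM s t := @exponent_sumM d j s t.
have ej : e (fg_gen j) = 1%R by rewrite /e exponent_sum_gen eqxx.
have ek : e (fg_gen k) = 0%R by rewrite /e exponent_sum_gen eq_sym (negbTE jk).
have [Lam HLam] := uniform_visit_mod eM ej cc cc' cK min_alpha wm_alpha.
have [tau [[tauc tau0] tauD per thick]] := thick_periodic_flow R Lam.
have d40 : (0 < delta / 4)%R by rewrite divr_gt0.
have [N HN] := choice (fun s => cylinder_mdist (@act_continuous _ _ alpha s)
  d40).
have [n1 Hn1] := cylinder_mdist (fun _ => cvg_id) d40.
have [nA HnA] := cylinder_clopen cA.
(* At depth [m], [jn] displaces points by less than [delta / 4], so does its effect after each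
   [alpha s] with [s] in [E], and [A] depends only on the [X]-component. *)
pose m := (n1 + nA + \max_(s <- enum_fset E) N s)%N.
pose sp := deinterleave c c' m; pose jn := interleave c c' m.
have spK : cancel sp jn by exact: deinterleaveK.
have jnK : cancel jn sp by exact: interleaveK.
have spc : continuous sp by exact: deinterleave_continuous.
have jnc : continuous jn by exact: interleave_continuous.
have jncyl xy : cylinder c m xy.1 (jn xy) by exact: interleave_cylinder.
pose beta := product_action eM tauc tau0 tauD spK jnK spc jnc alpha.
have betaE s x y : beta s (jn (x, y)) = jn (alpha s x, tau (e s) y).
  exact: product_actionE.
exists beta; split.
- split.
  + exact: (product_minimal eM ej tauc tau0 tauD spK jnK spc jnc cc' cK HLam
    per).
  + exact: product_topologically_free.
  + exact: (product_weakly_mixing eM ej tauc tau0 tauD spK jnK spc jnc cc' cK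
    thick).
  + exact: (product_invariant_probability tauD jnc (point : cantor_space)
      betaE (coord_compact cc' cK) clopen_base mu_alpha).
- move=> s sE; apply: (@le_lt_trans _ _ (delta / 2)%:E); last first.
    by rewrite lte_fin ltr_pdivrMr//; lra.
  apply: ge_ereal_sup => _ [z _ <-]; rewrite lee_fin -[z]spK.
  case: (sp z) => x y; rewrite betaE.
  apply: le_trans (metric_triangle _ (alpha s x) _) _.
  have -> : (delta / 2 = delta / 4 + delta / 4)%R by lra.
  apply/ltW/ltrD.
    apply: Hn1; apply: (cylinder_leq (n := m)); first by rewrite /m; lia.
    exact: (jncyl (_, _)).
  rewrite metric_sym; apply: HN; apply: (cylinder_leq (n := m));
    last exact: (jncyl (_, _)).
  apply: leq_trans (leq_addl _ _).
  exact: (@leq_bigmax_seq _ _ xpredT N s sE).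
- move=> iA; pose P := [set y : cantor_space | y 0%N = true].
  have Ajn xy : A (jn xy) <-> A xy.1.
    apply: iff_sym; apply: HnA; apply: (cylinder_leq (n := m)) (jncyl xy).
    by rewrite /m; lia.
  pose pt b : X * cantor_space := ((sp a0).1, fun=> b).
  have Apt b : A (jn (pt b)) by apply/Ajn; apply/(Ajn (sp a0)); rewrite spK.
  have Ppt b : P (sp (jn (pt b))).2 = (b = true) by rewrite jnK.
  exists (A `&` (fun z => (sp z).2) @^-1` P); split.
  + apply: clopenI => //; apply: preimage_clopen; first exact: coord_clopen.
    move=> z; exact: (@continuous_comp _ _ _ sp snd z (spc z) cvg_snd).
  + move=> z; have := iA z; rewrite -[z]spK; case: (sp z) => x y.
    by rewrite betaE ek tau0 /setI /preimage /mkset !jnK; tauto.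
  + by move=> z [].
  + by exists (jn (pt true)); split; [exact: Apt|rewrite /preimage /mkset Ppt].
  + exists (jn (pt false)); split; first exact: Apt.
    by move=> [_]; rewrite /preimage /mkset Ppt.
Qed.

End Density.

(** * The countable cover by nowhere dense sets *)

Theorem proposition8p6 (R : realType) (X : pmetricType R)
    (hX : homeomorphic X cantor_space) (d : nat) (hd : (2 <= d)%N) :
  comeagre [set alpha : set_type (@WA R (free_group d) X) |
    forall k : 'I_d,
      factors_onto (restrict_cyclic (set_val alpha) (fg_gen k))
        (trivial_action (cyclic_subgroup (fg_gen k)) cantor_space)].
Proof.
have [c [c' [cc cc' cK c'K]]] := hX.
have cX : compact [set: X] := coord_compact cc' cK.
have [enumc] := clopen_surj cX.
pose good k A (alpha : set_type (@WA R (free_group d) X)) :=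
  A !=set0 -> invariant (set_val alpha) (fg_gen k) A ->
  splits (set_val alpha) (fg_gen k) A.
exists (fun n => if @choice.unpickle ('I_d * nat)%type n is Some (k, i)
  then [set alpha | ~ good k (enumc i) alpha] else set0).
split=> [n|alpha /= nfac]; last first.
  apply: contrapT => nbad; apply: nfac => k; apply: splits_factors_onto => //.
  move=> A cA iA A0; have [i _ Ei] := @surj _ _ _ _ enumc A cA.
  apply: contrapT => nsp; apply: nbad; exists (choice.pickle (k, i)) => //.
  by rewrite /= choice.pickleK /= Ei => /(_ A0 iA).
rewrite /nowhere_dense; case: choice.unpickle => [[k i]|]; last first.
  by rewrite closure0 interior0.
apply/seteqP; split => // alpha; set A := enumc i.
have cA : clopen A by exact: funS.
move=> nalpha; have [A0|nA0] := pselect (A !=set0); last first.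
  have [beta [nb _]] := nbhs_singleton nalpha _ filterT.
  by case: nb => /nA0.
move: nalpha => [W [[V oV <-] /= Va WN]].
have [E [delta [delta0 EV]]] := nbhs_act_ball (open_nbhs_nbhs (conj oV Va)).
have [beta [WAbeta ball_beta gbeta]] := splits_dense cc cc' cK c'K k E hd
  (set_mem (svalP alpha)) delta0 cA A0.
have [E' [delta' [delta'0 Hgood]]] := splits_open cX cA gbeta.
(* [beta] lies in the closure of the bad set, yet has a neighbourhood of good actions. *)
have := WN (exist _ beta (mem_set WAbeta)) (EV _ ball_beta).
move=> /(_ (set_val @^-1` act_ball beta E' delta'))[|gamma [ngamma bgamma]].
  exists (set_val @^-1` (act_ball beta E' delta')°); split.
  - by exists (act_ball beta E' delta')° => //; exact: open_interior.
  - exact: act_ball_is_nbhs.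
  - by move=> gamma; exact: interior_subset.
by apply: ngamma => _; exact: Hgood.
Qed.
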